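(* In the setting described in the context, suppose that the response map $y$ is continuous and piecewise $C^{1,1}$ over a finite partition $\{\mathcal R_i\}_{i=1}^N$ (in the sense given in the context). Assume that, for each active piece, the Jacobian of $y_i$ satisfies $$\|\mathrm Jy_i(s)-\mathrm Jy_i(t)\|\le L_i\|s-t\|$$ whenever $s,t$ lie in a neighborhood of $\overline{\mathcal R_i}$. If $x$ is $\delta$-regular with respect to this partition, i.e. $I_\delta(x)\subseteq I(x)$, then $$\omega_y^c(x,\delta)\le\Big(\max_{i\in I(x)}L_i\Big)\delta .$$ Consequently, $$\operatorname{dist}\big(g_\delta(x),\partial^c\tilde\varphi(x)\big)\le\|d_y(x)\|\Big(\max_{i\in I(x)}L_i\Big)\delta .$$
   Context: $\|\cdot\|$ is the Euclidean norm for vectors and the corresponding operator norm for matrices; $\operatorname{dist}(z,\mathcal S)=\inf_{s\in\mathcal S}\|z-s\|$; $\mathbb B_n$ is the closed unit ball of $\mathbb R^n$; $B_\delta(x)=\{s:\|s-x\|\le\delta\}$. Throughout, $x\in\mathcal X$ and $0<\delta\le\bar\delta$. Response mapping. $\mathcal X\subset\mathbb R^n$ is nonempty, convex and compact, and $\mathcal N$ is an open neighborhood of $\mathcal X$. For each $x\in\mathcal N$ the lower-level solution set $\arg\min_{\xi\in\mathcal Y}g(x,\xi)$ (with $\mathcal Y\subseteq\mathbb R^m$) is a singleton $\{y(x)\}$, and the response map $y:\mathcal N\to\mathbb R^m$ is locally Lipschitz. A number $\bar\delta>0$ with $\mathcal X+\bar\delta\mathbb B_n\subseteq\mathcal N$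 is fixed; on $\mathcal X+\bar\delta\mathbb B_n$, $y$ is bounded and $L_y$-Lipschitz. Smoothing. $y_\delta(u)=\mathbb E_{\xi\sim\mathrm{Unif}(\mathbb B_n)}[y(u+\delta\xi)]$, with Jacobian $\mathrm Jy_\delta(u)\in\mathbb R^{m\times n}$. Upper-level objective. $\varphi\in C^1(\mathbb R^n\times\mathbb R^m)$ with partial gradients $\nabla_1\varphi$ (in the first argument) and $\nabla_2\varphi$ (in the second). There are finite constants $L_{1x},L_{1y},L_{2x},L_{2y},M_y>0$ such that, for all relevant pairs $(x,y),(x',y')$ at which these gradients are evaluated, $\|\nabla_1\varphi(x,y)-\nabla_1\varphi(x',y')\|\le L_{1x}\|x-x'\|+L_{1y}\|y-y'\|$, $\|\nabla_2\varphi(x,y)-\nabla_2\varphi(x',y')\|\le L_{2x}\|x-x'\|+L_{2y}\|y-y'\|$, and $\|\nabla_2\varphi(x,y)\|\le M_y$. Derived objects. $\tilde\varphi(x)=\varphi(x,y(x))$, $d_x(x)=\nabla_1\varphi(x,y(x))$, $d_y(x)=\nabla_2\varphi(x,y(x))$, and the Bi-ZOL approximate hypergradient is $g_\delta(x)=d_x(x)+\mathrm Jy_\delta(x)^\top d_y(x)$. Clarke objects. For a locally Lipschitz map $F$ on an open set, differentiable on the full-measure set $\Omega_F$, the Clarke generalized Jacobian is $\mathrm J^cF(x)=\operatorname{conv}\{\lim_k \mathrm JF(x^k): x^k\to x,\ x^k\in\Omega_F\}$; for a scalar locally Lipschitz function $f$, the Clarke subdifferential is $\partial^cf(x)=\operatorname{conv}\{\lim_k\nabla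 f(x^k):x^k\to x,\ x^k\in\Omega_f\}$. Local set variation: $\omega_y^c(x,\delta)=\sup_{\|s-x\|\le\delta}\ \sup_{V\in\mathrm J^cy(s)}\operatorname{dist}(V,\mathrm J^cy(x))$. Piecewise structure. On a neighborhood of $\mathcal X$, $y$ is continuous and piecewise smooth (here piecewise $C^{1,1}$) over a finite partition $\{\mathcal R_i\}_{i=1}^N$: $y(u)=y_i(u)$ for $u\in\mathcal R_i$, where each $y_i$ is smooth (here $C^{1,1}$, i.e. continuously differentiable with Lipschitz Jacobian) on a neighborhood of $\overline{\mathcal R_i}$. Set $I(x)=\{i:x\in\overline{\mathcal R_i}\}$ (active pieces at $x$) and $I_\delta(x)=\{i:\mathcal R_i\cap B_\delta(x)\neq\emptyset\}$; $x$ is called $\delta$-regular with respect to the partition if $I_\delta(x)\subseteq I(x)$.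
   Formalization: ''Partition'' is taken to mean pieces that cover a neighborhood of X, are closed relative to it, lie in the closure of their interiors and have disjoint interiors; this neighborhood is also required to contain B_δ(x). For arbitrary disjoint pieces or smaller neighborhoods the bound can fail. *)

(* Defs.v *)
From HB Require Import structures.
From mathcomp Require Export all_boot all_order all_algebra.
From mathcomp Require Export all_classical all_reals all_analysis.
Export Order.TTheory GRing.Theory Num.Theory.
Export numFieldNormedType.Exports.

Set Implicit Arguments.
Unset Strict Implicit.
Unset Printing Implicit Defensive.

Local Open Scope classical_set_scope.
Local Open Scope ring_scope.

(* Vectors of R^n are row vectors.  The library norm of 'M[R]_(m, n) is the sup
   norm; only its topology and its notion of derivative are used (both are
   independent of the norm), every estimate being stated with enorm or opnorm. *)

Section EuclideanNorms.
Context {R : realType}.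

Definition enorm n (v : 'rV[R]_n) : R := Num.sqrt (\sum_i v 0 i ^+ 2).

Definition unit_ball n : set 'rV[R]_n := [set v | enorm v <= 1].
Arguments unit_ball : clear implicits.

(* A : 'M_(m, n) is the linear map R^n -> R^m sending the row v to v A^T. *)
Definition opnorm m n (A : 'M[R]_(m, n)) : R :=
  sup [set enorm (v *m A^T) | v in unit_ball n].

Definition cball n (x : 'rV[R]_n) (d : R) : set 'rV[R]_n :=
  [set s | enorm (s - x) <= d].

Definition enlarge n (X : set 'rV[R]_n) (d : R) : set 'rV[R]_n :=
  [set u + d *: v | u in X & v in unit_ball n].

(* Extended-real valued, so that the distance to the empty set is +oo. *)
Definition edist (V : zmodType) (nrm : V -> R) (z : V) (S : set V) : \bar R :=
  ereal_inf [set (nrm (z - s))%:E | s in S].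

Definition lipschitz_in n (V : zmodType) (nrm : V -> R) (L : R)
    (A : set 'rV[R]_n) (f : 'rV[R]_n -> V) : Prop :=
  forall s t, A s -> A t -> nrm (f s - f t) <= L * enorm (s - t).

Definition locally_lipschitz n m (D : set 'rV[R]_n)
    (f : 'rV[R]_n -> 'rV[R]_m) : Prop :=
  forall u, D u -> exists K, exists2 W, nbhs u W &
    lipschitz_in (@enorm m) K (W `&` D) f.

Definition conv_hull (V : lmodType R) (S : set V) : set V :=
  [set v | exists k (c : 'I_k -> R) (p : 'I_k -> V),
    [/\ forall i, 0 <= c i, \sum_i c i = 1, forall i, S (p i)
      & v = \sum_i c i *: p i]].

End EuclideanNorms.

Arguments unit_ball {R} n.


Section Derivatives.
Context {R : realType}.

(* The library's jacobian acts on row vectors from the right, hence it is the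
   transpose of the usual m x n Jacobian. *)
Definition Jac n m (F : 'rV[R]_n -> 'rV[R]_m) (x : 'rV[R]_n) : 'M[R]_(m, n) :=
  (jacobian F x)^T.

Definition grad n (f : 'rV[R]_n -> R) (x : 'rV[R]_n) : 'rV[R]_n :=
  \row_j ('d f x : 'rV[R]_n -> R) (delta_mx 0 j).

Definition grad1 n m (phi : 'rV[R]_n * 'rV[R]_m -> R)
    (p : 'rV[R]_n * 'rV[R]_m) : 'rV[R]_n := grad (fun u => phi (u, p.2)) p.1.

Definition grad2 n m (phi : 'rV[R]_n * 'rV[R]_m -> R)
    (p : 'rV[R]_n * 'rV[R]_m) : 'rV[R]_m := grad (fun v => phi (p.1, v)) p.2.

(* In finite dimension, continuity of p |-> 'd phi p is continuity of all the
   p |-> 'd phi p v. *)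
Definition C1 n m (phi : 'rV[R]_n * 'rV[R]_m -> R) : Prop :=
  (forall p, differentiable phi p) /\
  (forall v, continuous (fun p => ('d phi p : _ -> R) v)).

(* C^{1,1} on a neighborhood of C; a Lipschitz Jacobian is continuous. *)
Definition C11_near n m (C : set 'rV[R]_n) (F : 'rV[R]_n -> 'rV[R]_m) : Prop :=
  exists W K, [/\ open W, C `<=` W, forall u, W u -> differentiable F u
    & lipschitz_in (@opnorm R m n) K W (Jac F)].

Definition diff_pts n (V : normedModType R) (D : set 'rV[R]_n)
    (F : 'rV[R]_n -> V) : set 'rV[R]_n := [set u | D u /\ differentiable F u].

Definition clarke_jac n m (D : set 'rV[R]_n) (F : 'rV[R]_n -> 'rV[R]_m)
    (x : 'rV[R]_n) : set 'M[R]_(m, n) :=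
  conv_hull [set V : 'M[R]_(m, n) | exists xs : nat -> 'rV[R]_n,
    [/\ forall k, diff_pts D F (xs k), xs @ \oo --> x
      & (fun k => Jac F (xs k)) @ \oo --> V]].

Definition clarke_subdiff n (D : set 'rV[R]_n) (f : 'rV[R]_n -> R)
    (x : 'rV[R]_n) : set 'rV[R]_n :=
  conv_hull [set g : 'rV[R]_n | exists xs : nat -> 'rV[R]_n,
    [/\ forall k, diff_pts D f (xs k), xs @ \oo --> x
      & (fun k => grad f (xs k)) @ \oo --> g]].

Definition clarke_variation n m (D : set 'rV[R]_n) (F : 'rV[R]_n -> 'rV[R]_m)
    (x : 'rV[R]_n) (d : R) : \bar R :=
  ereal_sup [set ereal_sup [set edist (@opnorm R m n) V (clarke_jac D F x)
                           | V in clarke_jac D F s]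
            | s in cball x d].

End Derivatives.

(* Lebesgue measure on R^n, carried by n-tuples (which, unlike 'rV[R]_n, come
   with a product sigma-algebra) and defined as the iterated product measure. *)
Section LebesgueTuple.
Context {R : realType}.

Definition cons_tuple n (p : measurableTypeR R * n.-tuple (measurableTypeR R)) :
  n.+1.-tuple (measurableTypeR R) := [tuple of p.1 :: p.2].

Lemma measurable_cons_tuple n : measurable_fun setT (@cons_tuple n).
Proof. by apply: measurable_cons. Qed.

Section Step.
Context n
  (mu : {sigma_finite_measure set (n.-tuple (measurableTypeR R)) -> \bar R}).

Definition lebesgue_step : set (n.+1.-tuple (measurableTypeR R)) -> \bar R :=
  pushforward (lebesgue_measure \x mu)%E (@cons_tuple n).

Let step0 : lebesgue_step set0 = 0%E.
Proof. by rewrite /lebesgue_step /pushforward preimage_set0 measure0. Qed.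

Let step_ge0 A : (0 <= lebesgue_step A)%E.
Proof. by rewrite /lebesgue_step /pushforward measure_ge0. Qed.

Let step_sigma_additive : semi_sigma_additive lebesgue_step.
Proof.
have mpre A : measurable A -> measurable (@cons_tuple n @^-1` A).
  by move=> mA; rewrite -[X in measurable X]setTI; exact: measurable_cons_tuple.
move=> F mF tF mUF; rewrite /lebesgue_step /pushforward preimage_bigcup.
apply: measure_semi_sigma_additive.
- by move=> k; exact: mpre.
- apply/trivIsetP => /= i j _ _ ij; rewrite -preimage_setI.
  by move/trivIsetP : tF => /(_ _ _ _ _ ij) ->//; rewrite preimage_set0.
- by rewrite -preimage_bigcup; exact: mpre.
Qed.

HB.instance Definition _ := isMeasure.Build _ _ _ lebesgue_step
  step0 step_ge0 step_sigma_additive.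

Let step_sigma_finite : sigma_finite setT lebesgue_step.
Proof.
pose H (A : set (measurableTypeR R)) (B : set (n.-tuple (measurableTypeR R))) :=
  [set t : n.+1.-tuple (measurableTypeR R) | A (thead t)]
    `&` [set t : n.+1.-tuple (measurableTypeR R) | B [tuple of behead t]].
have mH A B : measurable A -> measurable B -> measurable (H A B).
  move=> mA mB; apply: measurableI.
    rewrite -[X in measurable X]setTI.
    exact: (@measurable_tnth _ (measurableTypeR R) n.+1 ord0).
  rewrite -[X in measurable X]setTI.
  exact: (@measurable_behead _ (measurableTypeR R) n).
have H_pre A B : @cons_tuple n @^-1` H A B = A `*` B.
  apply/seteqP; split=> -[a t]; rewrite /H /cons_tuple /= theadE;
    by rewrite (_ : [tuple of _] = t)//; exact/val_inj.
have /sigma_finiteP[F [FT ndF Foo]] :=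
  sigma_finiteT (@lebesgue_measure R : {sigma_finite_measure set _ -> \bar R}).
have /sigma_finiteP[G [GT ndG Goo]] := sigma_finiteT mu.
exists (fun k => H (F k) (G k)).
  apply/seteqP; split=> // t _.
  have [i _ Fi] : (\bigcup_i F i) (thead t) by rewrite -FT.
  have [j _ Gj] : (\bigcup_i G i) [tuple of behead t] by rewrite -GT.
  exists (maxn i j) => //; split => /=.
    by move: Fi; exact/subsetPset/ndF/leq_maxl.
  by move: Gj; exact/subsetPset/ndG/leq_maxr.
move=> k; have [mF Fk] := Foo k; have [mG Gk] := Goo k; split; first exact: mH.
rewrite /lebesgue_step /pushforward H_pre product_measure1E//.
by rewrite lte_mul_pinfty// ge0_fin_numE.
Qed.

HB.instance Definition _ := Measure_isSigmaFinite.Build _ _ _ lebesgue_step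
  step_sigma_finite.

End Step.

Fixpoint lebesgue_tuple n :
    {sigma_finite_measure set (n.-tuple (measurableTypeR R)) -> \bar R} :=
  if n is n'.+1 then lebesgue_step (lebesgue_tuple n')
  else \d_ [tuple].

End LebesgueTuple.

Section Smoothing.
Context {R : realType}.

Definition vec n (t : n.-tuple (measurableTypeR R)) : 'rV[R]_n :=
  \row_i (tnth t i : R).

(* E[h(xi)] for xi uniform on the closed Euclidean unit ball. *)
Definition ball_mean n (h : 'rV[R]_n -> R) : R :=
  (\int[lebesgue_tuple n]_(t in @vec n @^-1` unit_ball n) h (vec t))
    / fine (lebesgue_tuple n (@vec n @^-1` unit_ball n)).

Definition smoothing n m (y : 'rV[R]_n -> 'rV[R]_m) (d : R) (u : 'rV[R]_n) :
    'rV[R]_m :=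
  \row_j ball_mean (fun xi => y (u + d *: xi) 0 j).

(* For row vectors, (Jac _ x)^T d_y reads d_y *m Jac _ x. *)
Definition bizol_hypergrad n m (phi : 'rV[R]_n * 'rV[R]_m -> R)
    (y : 'rV[R]_n -> 'rV[R]_m) (d : R) (x : 'rV[R]_n) : 'rV[R]_n :=
  grad1 phi (x, y x) + grad2 phi (x, y x) *m Jac (smoothing y d) x.

End Smoothing.

Section Pieces.
Context {R : realType}.

(* A finite partition of the open set U in the sense used for piecewise smooth
   maps (e.g. polyhedral partitions): full-dimensional pieces, closed in U, that
   overlap on their boundaries only.  Full-dimensionality makes every active
   piece contribute to the Clarke Jacobian; closedness in U makes every piece
   contributing at some point of a closed ball meet that ball. *)
Definition partition_of n N (U : set 'rV[R]_n) (P : 'I_N -> set 'rV[R]_n) :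
    Prop :=
  [/\ U = \bigcup_i P i,
      forall i j, i != j -> interior (P i) `&` interior (P j) = set0,
      forall i, closure (P i) `&` U `<=` P i
    & forall i, P i `<=` closure (interior (P i))].

Definition piecewise_C11 n m N (U : set 'rV[R]_n) (P : 'I_N -> set 'rV[R]_n)
    (y : 'rV[R]_n -> 'rV[R]_m) (yi : 'I_N -> 'rV[R]_n -> 'rV[R]_m) : Prop :=
  [/\ partition_of U P,
      {within U, continuous y},
      forall i u, P i u -> y u = yi i u
    & forall i, C11_near (closure (P i)) (yi i)].

Definition active n N (P : 'I_N -> set 'rV[R]_n) (x : 'rV[R]_n) : set 'I_N :=
  [set i | closure (P i) x].

Definition active_near n N (P : 'I_N -> set 'rV[R]_n) (x : 'rV[R]_n) (d : R) :
    set 'I_N := [set i | P i `&` cball x d !=set0].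

Definition regular n N (P : 'I_N -> set 'rV[R]_n) (d : R) (x : 'rV[R]_n) :
    Prop := active_near P x d `<=` active P x.

(* The default value 0 of the maximum is immaterial: at a point covered by the
   partition some piece is active, and Lipschitz constants are nonnegative. *)
Definition max_active n N (P : 'I_N -> set 'rV[R]_n) (L : 'I_N -> R)
    (x : 'rV[R]_n) : R :=
  \big[Num.max/0]_(i < N | i \in active P x) L i.

End Pieces.

(* Main.v *)
(* Where y is differentiable, its Jacobian is that of an active piece; so the
   Clarke Jacobian at s is the hull of the Jac (yi i) s with i active at s: by
   full-dimensionality of the pieces all of them occur.  Under regularity the
   same indices are active at x, and the first bound is the Lipschitz estimate
   on the Jac (yi i), with unchanged convex weights.

   For the hypergradient no almost-everywhere differentiability is needed.  The
   smoothing F of a Lipschitz function is differentiable because its second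
   differences satisfy |F(h+w) - F(h) - F(w) + F(0)| <= C |h||w|: translating a
   unit ball by h changes it by a set of measure O(|h|).  By the mean value
   inequality for piecewise C^1 maps along segments, the derivative of p.y_delta
   at x in direction q is at least min_i p.(Jac (yi i) x)q - |p| max_i L_i delta |q|.
   Separation of a point from a polytope turns this family of inequalities into
   the distance bound, the vertices d_x + d_y Jac (yi i) x of the polytope being
   limiting gradients of u |-> phi(u, y u). *)

Require Import Defs.
From mathcomp Require Import ring lra archimedean measurable_realfun.

Set Implicit Arguments.
Unset Strict Implicit.
Unset Printing Implicit Defensive.

Local Open Scope classical_set_scope.
Local Open Scope ring_scope.

(** * Euclidean and operator norms *)

Section Euclidean.
Context {R : realType}.

(** Both bounds rest on the same Lipschitz estimate [piece_Jac_lip], but the second is obtained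
    directly rather than from the first. One direction q is tested at a time: an increment of
    p.y_delta is the mean of increments of p.y, and lower bounds on the latter suffice, because
    separation asks, for each q, only for one vertex whose pairing with q is not much larger than
    that of the hypergradient.

    Differentiability of y_delta at x has to be established separately, since the Jacobian of a
    non-differentiable map carries no information; there only the quadratic order of the remainder
    matters, not its constant.

    The obstacle is that x + h + delta xi can leave the closed delta-ball as soon as h is nonzero,
    whereas regularity speaks of that ball alone. Compactness enlarges it by some rho > 0
    ([regular_radius]), and every estimate on y_delta takes place in the open ball of radius delta +
    rho around x. *)

Definition dot n (u v : 'rV[R]_n) : R := \sum_i u 0 i * v 0 i.

Lemma dotC n (u v : 'rV[R]_n) : dot u v = dot v u.
Proof. by apply: eq_bigr => i _; rewrite mulrC. Qed.

Lemma dotDr n (u v w : 'rV[R]_n) : dot u (v + w) = dot u v + dot u w.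
Proof. by rewrite -big_split; apply: eq_bigr => i _; rewrite mxE mulrDr. Qed.

Lemma dotZr n a (u v : 'rV[R]_n) : dot u (a *: v) = a * dot u v.
Proof. by rewrite mulr_sumr; apply: eq_bigr => i _; rewrite mxE mulrCA. Qed.

Lemma dotNr n (u v : 'rV[R]_n) : dot u (- v) = - dot u v.
Proof. by rewrite -scaleN1r dotZr mulN1r. Qed.

Lemma dotBr n (u v w : 'rV[R]_n) : dot u (v - w) = dot u v - dot u w.
Proof. by rewrite dotDr dotNr. Qed.

Lemma dotDl n (u v w : 'rV[R]_n) : dot (u + v) w = dot u w + dot v w.
Proof. by rewrite dotC dotDr !(dotC w). Qed.

Lemma dotZl n a (u v : 'rV[R]_n) : dot (a *: u) v = a * dot u v.
Proof. by rewrite dotC dotZr dotC. Qed.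

Lemma dotNl n (u v : 'rV[R]_n) : dot (- u) v = - dot u v.
Proof. by rewrite dotC dotNr dotC. Qed.

Lemma dotBl n (u v w : 'rV[R]_n) : dot (u - v) w = dot u w - dot v w.
Proof. by rewrite dotDl dotNl. Qed.

Lemma dot_delta n (u : 'rV[R]_n) j : dot (delta_mx 0 j) u = u 0 j.
Proof.
rewrite /dot (bigD1 j)//= mxE !eqxx mul1r big1 ?addr0// => i ij.
by rewrite mxE (negPf ij) andbF mul0r.
Qed.

Lemma dot_mulmx n m (p : 'rV[R]_m) (A : 'M[R]_(m, n)) (q : 'rV[R]_n) :
  dot (p *m A) q = dot p (q *m A^T).
Proof.
rewrite /dot.
under eq_bigr => j _ do rewrite mxE mulr_suml.
rewrite exchange_big /=; apply: eq_bigr => i _.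
rewrite mxE mulr_sumr; apply: eq_bigr => j _.
by rewrite mxE mulrA mulrAC -mulrA.
Qed.

Lemma dotvv_ge0 n (v : 'rV[R]_n) : 0 <= dot v v.
Proof. by apply: sumr_ge0 => i _; rewrite -expr2 sqr_ge0. Qed.

Lemma enorm_ge0 n (v : 'rV[R]_n) : 0 <= enorm v.
Proof. exact: sqrtr_ge0. Qed.

Lemma enorm_sqr n (v : 'rV[R]_n) : enorm v ^+ 2 = dot v v.
Proof.
rewrite sqr_sqrtr; last by apply: sumr_ge0 => i _; exact: sqr_ge0.
by apply: eq_bigr => i _; rewrite expr2.
Qed.

Lemma enormE n (v : 'rV[R]_n) : enorm v = Num.sqrt (dot v v).
Proof. by rewrite -enorm_sqr sqrtr_sqr ger0_norm// enorm_ge0. Qed.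

Lemma enorm_le n (v : 'rV[R]_n) a : 0 <= a -> dot v v <= a ^+ 2 -> enorm v <= a.
Proof.
by move=> a0 va; rewrite -(ler_pXn2r (n:=2))// ?nnegrE ?enorm_ge0// enorm_sqr.
Qed.

Lemma enormZ n a (v : 'rV[R]_n) : enorm (a *: v) = `|a| * enorm v.
Proof.
by rewrite !enormE dotZr dotZl mulrA -expr2 sqrtrM ?sqr_ge0// sqrtr_sqr.
Qed.

Lemma enormN n (v : 'rV[R]_n) : enorm (- v) = enorm v.
Proof. by rewrite -scaleN1r enormZ normrN1 mul1r. Qed.

Lemma enormBC n (u v : 'rV[R]_n) : enorm (u - v) = enorm (v - u).
Proof. by rewrite -enormN opprB. Qed.

Lemma enorm0 n : enorm (0 : 'rV[R]_n) = 0.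
Proof. by rewrite -(scale0r (0 : 'rV[R]_n)) enormZ normr0 mul0r. Qed.

Lemma abs_coord_le_enorm n (v : 'rV[R]_n) i : `|v 0 i| <= enorm v.
Proof.
rewrite -(ler_pXn2r (n:=2))// ?nnegrE ?enorm_ge0// enorm_sqr.
rewrite real_normK ?num_real// /dot (bigD1 i)//= expr2 lerDl.
by apply: sumr_ge0 => j _; rewrite -expr2 sqr_ge0.
Qed.

Lemma enorm_eq0 n (v : 'rV[R]_n) : enorm v = 0 -> v = 0.
Proof.
move=> v0; apply/rowP => i; rewrite mxE; apply/eqP; rewrite -normr_le0 -v0.
exact: abs_coord_le_enorm.
Qed.

(** Cauchy-Schwarz: expand the squared norm of |v| u - |u| v, which is nonnegative, and divide by
    |u| |v|. *)
Lemma dot_le_enorm n (u v : 'rV[R]_n) : dot u v <= enorm u * enorm v.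
Proof.
have [/enorm_eq0 ->|u0] := eqVneq (enorm u) 0.
  by rewrite enorm0 mul0r -(scale0r u) dotZl mul0r.
have [/enorm_eq0 ->|v0] := eqVneq (enorm v) 0.
  by rewrite enorm0 mulr0 -(scale0r u) dotZr mul0r.
have ugt : 0 < enorm u by rewrite lt_def u0 enorm_ge0.
have vgt : 0 < enorm v by rewrite lt_def v0 enorm_ge0.
have := dotvv_ge0 (enorm v *: u - enorm u *: v).
rewrite !(dotBl, dotBr, dotZl, dotZr) -!enorm_sqr (dotC v u) => h.
rewrite -(ler_pM2l (mulr_gt0 ugt vgt)); move: h.
by nra.
Qed.

Lemma abs_dot_le n (u v : 'rV[R]_n) : `|dot u v| <= enorm u * enorm v.
Proof.
rewrite ler_norml dot_le_enorm andbT -(enormN u) lerNl -dotNl.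
exact: dot_le_enorm.
Qed.

Lemma enormD n (u v : 'rV[R]_n) : enorm (u + v) <= enorm u + enorm v.
Proof.
apply: enorm_le; first by rewrite addr_ge0// enorm_ge0.
rewrite !(dotDl, dotDr) -!enorm_sqr (dotC v u).
have := dot_le_enorm u v; nra.
Qed.

Lemma enorm_sum n I (r : seq I) (Q : pred I) (F : I -> 'rV[R]_n) :
  enorm (\sum_(i <- r | Q i) F i) <= \sum_(i <- r | Q i) enorm (F i).
Proof.
elim/big_rec2 : _ => [|i a b _ h]; first by rewrite enorm0.
by rewrite (le_trans (enormD _ _))// lerD2l.
Qed.

Lemma enormB_le n (u v w : 'rV[R]_n) :
  enorm (u - w) <= enorm (u - v) + enorm (v - w).
Proof. by rewrite -{1}(subrK v u) -addrA enormD. Qed.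

Lemma mxnorm_le m n (A : 'M[R]_(m, n)) a :
  0 <= a -> (forall i j, `|A i j| <= a) -> `|A| <= a.
Proof.
move=> a0 h; rewrite /Num.norm/= mx_normrE; exact: bigmax_le.
Qed.

Lemma coord_le_mxnorm m n (A : 'M[R]_(m, n)) i j : `|A i j| <= `|A|.
Proof.
rewrite [leRHS]/Num.norm/= mx_normrE.
by apply: le_trans (le_bigmax _ _ (i, j)); rewrite /=.
Qed.

Lemma mxnorm_le_enorm n (v : 'rV[R]_n) : `|v| <= enorm v.
Proof.
apply: mxnorm_le; first exact: enorm_ge0.
by move=> i j; rewrite ord1; exact: abs_coord_le_enorm.
Qed.

(** The constant n + 1 is cruder than the square root of n, but stays positive when n = 0, so it can
    be divided by. *)
Lemma enorm_le_mxnorm n (v : 'rV[R]_n) : enorm v <= n.+1%:R * `|v|.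
Proof.
apply: enorm_le; first by rewrite mulr_ge0.
apply: (@le_trans _ _ (n%:R * `|v| ^+ 2)).
  apply: (@le_trans _ _ (\sum_(i < n) `|v| ^+ 2)).
    apply: ler_sum => i _; rewrite -expr2 -real_normK ?num_real//.
    by rewrite lerXn2r ?nnegrE// coord_le_mxnorm.
  by rewrite sumr_const card_ord mulr_natl.
rewrite exprMn ler_wpM2r ?exprn_ge0//.
by rewrite -natrX ler_nat (leq_trans (leqnSn _))// -{1}(expn1 n.+1) leq_pexp2l.
Qed.

(** The bridge between the library topology, defined by the sup norm, and the Euclidean estimates
    used throughout. *)
Lemma nbhs_enormP n (x : 'rV[R]_n) (A : set 'rV[R]_n) :
  nbhs x A <-> exists2 e, 0 < e & forall s, enorm (s - x) < e -> A s.
Proof.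
split=> [/nbhs_ballP[e /= e0 eA]|[e e0 eA]].
  exists e => // s sx; apply: eA; rewrite -ball_normE/=.
  by rewrite distrC (le_lt_trans (mxnorm_le_enorm _)).
apply/nbhs_ballP; exists (e / n.+1%:R) => /=; first exact: divr_gt0.
move=> s; rewrite -ball_normE/= distrC => sx; apply: eA.
rewrite (le_lt_trans (enorm_le_mxnorm _))// mulrC.
by rewrite -ltr_pdivlMr.
Qed.

Lemma cvg_enormP n T (F : set_system T) {FF : Filter F} (f : T -> 'rV[R]_n)
    (x : 'rV[R]_n) :
  f @ F --> x <-> forall e, 0 < e -> \forall t \near F, enorm (f t - x) < e.
Proof.
split=> [fx e e0|h A /nbhs_enormP[e e0 eA]].
  by apply: (fx [set s | enorm (s - x) < e]); apply/nbhs_enormP; exists e.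
by near=> t; apply: eA; near: t; exact: h.
Unshelve. all: by end_near. Qed.

Lemma enorm_continuous n : continuous (@enorm R n).
Proof.
move=> x; apply/(@cvgrPdist_lt _ _ _ (nbhs x)) => e e0; apply/nbhs_enormP; exists e => // s sx.
rewrite ltr_norml; have := enormD (s - x) x; have := enormD (x - s) s.
rewrite !subrK (enormBC x); lra.
Qed.

(** [sup] is meaningful only for nonempty bounded sets. Coordinate i of the image of v is the
    pairing of v with row i of A, so the sum of the row norms is a bound. *)
Lemma opnorm_has_sup m n (A : 'M[R]_(m, n)) :
  has_sup [set enorm (v *m A^T) | v in unit_ball n].
Proof.
split; first by exists (enorm (0 *m A^T)), 0 => //=; rewrite /unit_ball/= enorm0.
exists (\sum_i enorm (row i A)) => _ [v /= v1 <-].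
rewrite [X in enorm X](_ : _ = \sum_i dot (row i A) v *: delta_mx 0 i).
  apply: le_trans (enorm_sum _ _ _) _; apply: ler_sum => i _.
  rewrite enormZ [X in _ * X](_ : _ = 1) ?mulr1; last first.
    by rewrite enormE dot_delta mxE !eqxx sqrtr1.
  rewrite (le_trans (abs_dot_le _ _))//.
  by rewrite ler_piMr// enorm_ge0.
apply/rowP => i; rewrite mxE summxE [RHS](bigD1 i)//= [X in _ = _ + X]big1 => [|k ki].
  rewrite !mxE !eqxx mulr1 addr0; apply: eq_bigr => j _.
  by rewrite !mxE mulrC.
by rewrite !mxE (eq_sym i) (negPf ki) andbF mulr0.
Qed.

Lemma opnorm_ge0 m n (A : 'M[R]_(m, n)) : 0 <= opnorm A.
Proof.
have [_ ub] := opnorm_has_sup A.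
apply: (le_trans (enorm_ge0 (0 *m A^T))); apply: sup_ubound => //.
by exists 0 => //=; rewrite /unit_ball/= enorm0.
Qed.

Lemma enorm_mulmx_le m n (A : 'M[R]_(m, n)) (v : 'rV[R]_n) :
  enorm (v *m A^T) <= opnorm A * enorm v.
Proof.
have [/enorm_eq0 ->|v0] := eqVneq (enorm v) 0.
  by rewrite mul0mx !enorm0 mulr0.
have vgt : 0 < enorm v by rewrite lt_def v0 enorm_ge0.
rewrite -ler_pdivrMr//.
rewrite (_ : _ / _ = enorm (((enorm v)^-1 *: v) *m A^T)); last first.
  by rewrite -scalemxAl enormZ ger0_norm ?invr_ge0 ?enorm_ge0// mulrC.
apply: sup_ubound; first by have [] := opnorm_has_sup A.
exists ((enorm v)^-1 *: v) => //=.
by rewrite /unit_ball/= enormZ ger0_norm ?invr_ge0 ?enorm_ge0// mulVf.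
Qed.

Lemma opnorm_le m n (A : 'M[R]_(m, n)) a : 0 <= a ->
  (forall v, enorm (v *m A^T) <= a * enorm v) -> opnorm A <= a.
Proof.
move=> a0 h; have [ne _] := opnorm_has_sup A.
apply: ge_sup => // _ [v /= v1 <-].
by rewrite (le_trans (h v))// ler_piMr.
Qed.

Lemma opnorm_conv m n k (c : 'I_k -> R) (A : 'I_k -> 'M[R]_(m, n)) a :
  (forall i, 0 <= c i) -> \sum_i c i = 1 -> (forall i, opnorm (A i) <= a) ->
  opnorm (\sum_i c i *: A i) <= a.
Proof.
move=> c0 c1 hA.
(* An index exists because weights summing to 1 exclude k = 0. *)
have a0 : 0 <= a.
  have [k0|k0] := posnP k; last exact: le_trans (opnorm_ge0 _) (hA (Ordinal k0)).
  by move: c1; subst k; rewrite big_ord0 => /eqP; rewrite eq_sym oner_eq0.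
apply: opnorm_le => // v.
rewrite linear_sum /= mulmx_sumr (le_trans (enorm_sum _ _ _))//.
rewrite -(mul1r (a * _)) -c1 mulr_suml; apply: ler_sum => i _.
rewrite linearZ/= -scalemxAr enormZ ger0_norm// ler_wpM2l//.
by rewrite (le_trans (enorm_mulmx_le _ _))// ler_wpM2r// enorm_ge0.
Qed.

(** Turns estimates in operator norm into convergence for the library topology on matrices. *)
Lemma mxnorm_le_opnorm m n (A : 'M[R]_(m, n)) : `|A| <= opnorm A.
Proof.
apply: mxnorm_le; first exact: opnorm_ge0.
move=> i j; have := enorm_mulmx_le A (delta_mx 0 j).
rewrite [X in _ * X](_ : _ = 1) ?mulr1; last first.
  by rewrite enormE dot_delta mxE !eqxx sqrtr1.
apply: le_trans; apply: le_trans (abs_coord_le_enorm _ i).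
by rewrite -rowE !mxE.
Qed.

End Euclidean.

(** * Lebesgue measure of Euclidean balls *)

Section LebesgueAffine.
Context {R : realType}.
Local Notation RT := (measurableTypeR R).
Local Notation lambda := (@lebesgue_measure R).

Lemma measurable_affine (c a : R) :
  measurable_fun setT (fun s : RT => c * s + a : RT).
Proof. by apply: measurable_funD => //; exact: measurable_funM. Qed.

(** The scaled pushforward agrees with Lebesgue measure on half-open intervals, which determines
    it. *)
Lemma lebesgue_measure_affine (c a : R) (A : set RT) : 0 < c -> measurable A ->
  (c%:E * lambda ((fun s : RT => (c * s + a)%R) @^-1` A) = lambda A)%E.
Proof.
move=> c0 mA.
pose c' : {nonneg R} := NngNum (ltW c0).
pose phi := (fun s => c * s + a) : RT -> RT.
have mphi : measurable_fun setT phi := measurable_affine c a.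
pose nu : {measure set RT -> \bar R} :=
  measure_function_pushforward__canonical__measure_function_Measure lambda mphi.
suff : lambda A = mscale c' nu A by move=> ->.
apply: lebesgue_measure_unique => //= _ [[u v] _ <-].
change (lambda `]u, v] = c%:E * lambda (phi @^-1` `]u, v]))%E.
rewrite (_ : _ @^-1` _ = `](u - a) / c, (v - a) / c]%classic); last first.
  apply/seteqP; split => s /=; rewrite !in_itv/= ltr_pdivrMr// ler_pdivlMr//;
    by rewrite ltrBlDr lerBrDr (mulrC s).
rewrite !lebesgue_measure_itv/= !lte_fin ltr_pM2r ?invr_gt0// ltrD2r.
case: ifPn => uv; rewrite ?mule0// -!EFinD -EFinM; congr _%:E.
by field; rewrite gt_eqF.
Qed.

Lemma ge0_integral_affine (c a : R) (f : RT -> \bar R) : 0 < c ->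
  measurable_fun setT f -> (forall s, 0 <= f s)%E ->
  (c%:E * \int[lambda]_s f (c * s + a)%R = \int[lambda]_s f s)%E.
Proof.
move=> c0 mf f0.
pose c' : {nonneg R} := NngNum (ltW c0).
pose phi := (fun s => c * s + a) : RT -> RT.
have mphi : measurable_fun setT phi := measurable_affine c a.
rewrite -[LHS]/(c%:E * \int[lambda]_(s in phi @^-1` setT) (f \o phi) s)%E.
pose nu : {measure set RT -> \bar R} :=
  measure_function_pushforward__canonical__measure_function_Measure lambda mphi.
rewrite -(ge0_integral_pushforward mphi)//.
rewrite -[c%:E]/(c'%:num%:E) -(@ge0_integral_mscale _ _ _ nu)//.
apply: eq_measure_integral => A mA _.
exact: lebesgue_measure_affine.
Qed.

Definition affine_tuple n (c : R) (a : 'I_n -> R) (t : n.-tuple RT) :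
  n.-tuple RT := [tuple c * tnth t i + a i | i < n].

Lemma measurable_affine_tuple n c (a : 'I_n -> R) :
  measurable_fun setT (affine_tuple c a).
Proof.
apply/measurable_fun_tnthP => i.
rewrite (_ : _ \o _ = fun t => c * tnth t i + a i); last first.
  by apply/funext => t /=; rewrite tnth_mktuple.
by apply: (measurableT_comp (measurable_affine c (a i))); exact: measurable_tnth.
Qed.

Lemma measurable_preim_affine_tuple n c (a : 'I_n -> R) A :
  measurable A -> measurable (affine_tuple c a @^-1` A).
Proof.
by move=> mA; rewrite -[X in measurable X]setTI; exact: measurable_affine_tuple.
Qed.

(** Induction on the dimension: the section at s of the preimage is the preimage of the section at c
    s + a_0 ([xs]), and each coordinate contributes one factor c. The case c = 1 is translation
    invariance; general c gives the volume of balls of any radius. *)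
Lemma lebesgue_tuple_affine n c (a : 'I_n -> R) A : 0 < c -> measurable A ->
  ((c ^+ n)%:E * lebesgue_tuple n (affine_tuple c a @^-1` A)
   = lebesgue_tuple n A)%E.
Proof.
move=> c0; elim: n a A => [|n IH] a A mA.
  rewrite expr0 mul1e; congr (lebesgue_tuple 0 _).
  by apply/seteqP; split => t /=; rewrite (tuple0 (affine_tuple c a t)) (tuple0 t).
pose a' i := a (lift ord0 i).
pose A' := @cons_tuple R n @^-1` A.
have mA' : measurable A'.
  by rewrite -[X in measurable X]setTI; exact: measurable_cons_tuple.
pose G s := lebesgue_tuple n (xsection A' s).
have mG : measurable_fun setT G by exact: measurable_fun_xsection.
have G0 s : (0 <= G s)%E by exact: measure_ge0.
have xs s : xsection (@cons_tuple R n @^-1` (affine_tuple c a @^-1` A)) s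
    = affine_tuple c a' @^-1` (xsection A' (c * s + a ord0)).
  apply/seteqP; split => t; rewrite /xsection/= !inE /A' /=;
    congr (A _); rewrite /cons_tuple; apply/eq_from_tnth => i;
    rewrite tnth_mktuple; case: (unliftP ord0 i) => [j|] ->;
    by rewrite ?tnthS ?tnth0//= ?tnth_mktuple// ?tnthS.
rewrite -[lebesgue_tuple n.+1 A]/(\int[lambda]_s G s)%E.
rewrite -[lebesgue_tuple n.+1 _]/(\int[lambda]_s
   lebesgue_tuple n (xsection (@cons_tuple R n @^-1` (affine_tuple c a @^-1` A)) s))%E.
rewrite -[RHS](@ge0_integral_affine c (a ord0))//.
rewrite exprS EFinM -muleA; congr (_ * _)%E.
rewrite -ge0_integralZl//; last 2 first.
- rewrite (_ : (fun _ => _) = fun s => lebesgue_tuple n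
    (xsection (@cons_tuple R n @^-1` (affine_tuple c a @^-1` A)) s))//.
  apply: measurable_fun_xsection.
  rewrite -[X in measurable X]setTI; apply: measurable_cons_tuple => //.
  exact: measurable_preim_affine_tuple.
- by rewrite lee_fin exprn_ge0// ltW.
apply: eq_integral => s _; rewrite xs IH//.
exact: measurable_xsection.
Qed.

End LebesgueAffine.

Section LebesgueBalls.
Context {R : realType}.
Local Notation RT := (measurableTypeR R).
Local Notation lambda := (@lebesgue_measure R).

Lemma measurable_tuple_box n (I : 'I_n -> interval R) :
  measurable [set t : n.-tuple RT | forall i, tnth t i \in I i].
Proof.
rewrite (_ : mkset _ = \bigcap_(i in [set: 'I_n])
    ((fun t : n.-tuple RT => tnth t i) @^-1` [set` I i])); last first.
  by apply/seteqP; split => t /= h i; [move=> _; exact: h | exact: h].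
apply: fin_bigcap_measurable => [|i _]; first exact: finite_finset.
rewrite -[X in measurable X]setTI.
by apply: (@measurable_tnth _ RT n i) => //; exact: measurable_itv.
Qed.

(** Tuples carry the product sigma-algebra, so O is written as the countable union of the boxes
    inside it with rational centres and radii 1 / (k + 1). *)
Lemma measurable_vec_open n (O : set 'rV[R]_n) :
  open O -> measurable (@vec R n @^-1` O).
Proof.
move=> oO.
pose I (q : 'rV[rat]_n) (k : nat) (i : 'I_n) : interval R :=
  `](ratr (q 0 i) - k.+1%:R^-1), (ratr (q 0 i) + k.+1%:R^-1)[.
pose box qk := [set t : n.-tuple RT | forall i, tnth t i \in I qk.1 qk.2 i].
pose F (qk : 'rV[rat]_n * nat) :=
  if `[< box qk `<=` @vec R n @^-1` O >] then box qk else set0.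
rewrite (_ : _ @^-1` _ = \bigcup_qk F qk); last first.
  apply/seteqP; split => [t /= Ot|t [qk _]]; last first.
    by rewrite /F; case: ifPn => // /asboolP h /h.
  have /nbhs_ballP[e /= e0 eO] : nbhs (vec t) O by exact: open_nbhs_nbhs.
  have [k ke] : exists k : nat, (k.+1%:R^-1 : R) < e / 2.
    have /ltr_add_invr[k hk] : 0 < e / 2 by rewrite divr_gt0.
    by exists k; rewrite add0r in hk.
  have kp : 0 < (k.+1%:R^-1 : R) by rewrite invr_gt0.
  have hq i : exists q : rat, ratr q \in
      `](tnth t i - k.+1%:R^-1 : R), (tnth t i + k.+1%:R^-1)[.
    by apply: rat_in_itvoo; rewrite ltrD2l gtrN.
  pose q : 'rV[rat]_n := \row_i projT1 (cid (hq i)).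
  have qi i : ratr (q 0 i) \in
      `](tnth t i - k.+1%:R^-1 : R), (tnth t i + k.+1%:R^-1)[.
    by rewrite mxE; exact: projT2 (cid (hq i)).
  exists (q, k) => //; rewrite /F asboolT => [|s /= hs].
    move=> i /=; move: (qi i); rewrite !in_itv/= /box/=.
    by move: (k.+1%:R^-1) => ep /andP[? ?]; lra.
  apply: eO; split => // i j; rewrite !mxE.
  move: (hs j) (qi j) ke; rewrite !in_itv/= /ball/= ltr_norml.
  by move: (k.+1%:R^-1) => ep /andP[? ?] /andP[? ?] ?; lra.
apply: countable_bigcupT_measurable => [|qk]; first exact: countableP.
by rewrite /F; case: ifPn => // _; exact: measurable_tuple_box.
Qed.

Lemma measurable_vec_closed n (O : set 'rV[R]_n) :
  closed O -> measurable (@vec R n @^-1` O).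
Proof.
move=> cO; rewrite -[X in measurable X]setCK; apply: measurableC.
by apply: (@measurable_vec_open _ (~` O)); rewrite openC.
Qed.

Lemma measurable_fun_vec n (O : set 'rV[R]_n) (f : 'rV[R]_n -> R) :
  open O -> {in O, continuous f} ->
  measurable_fun (@vec R n @^-1` O) (f \o @vec R n).
Proof.
move=> oO cf mO; apply: (measurability _ (RGenOInfty.measurableE R)) => //.
move=> _ [_ [a ->] <-].
rewrite [X in measurable X](_ : _ = @vec R n @^-1` (O `&` f @^-1` `]a, +oo[))//.
apply: measurable_vec_open; rewrite openE => u [Ou fu]; apply: filterI.
  exact: open_nbhs_nbhs.
apply: cf; first exact/mem_set.
exact: open_nbhs_nbhs.
Qed.

Definition ballT n (a : 'rV[R]_n) (r : R) := @vec R n @^-1` cball a r.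

Lemma unit_ballE n : @unit_ball R n = cball 0 1.
Proof. by apply/seteqP; split => v; rewrite /unit_ball/cball/= subr0. Qed.

Lemma closed_cball n (a : 'rV[R]_n) r : closed (cball a r).
Proof.
rewrite (_ : cball a r = (fun s => enorm (s - a)) @^-1` [set z | z <= r])//.
apply: closed_comp => [s _|]; last exact: closed_le.
apply: (@cvg_comp _ _ _ (fun s => s - a) (@enorm R n) _ (nbhs (s - a))).
  apply/(@cvg_enormP _ _ _ (nbhs s)) => e e0; apply/nbhs_enormP.
  exists e => // t.
  by rewrite opprB addrA subrK.
exact: enorm_continuous.
Qed.

Lemma measurable_ballT n (a : 'rV[R]_n) r : measurable (ballT a r).
Proof. by apply: measurable_vec_closed; exact: closed_cball. Qed.

Lemma lebesgue_tuple_cube n (r : R) : 0 < r ->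
  lebesgue_tuple n [set t : n.-tuple RT | forall i, tnth t i \in `[(- r), r]]
  = ((2 * r) ^+ n)%:E.
Proof.
move=> r0; elim: n => [|n IH].
  by rewrite /= diracE mem_set//= => -[].
set C := mkset _.
rewrite -[LHS]/((lambda \x lebesgue_tuple n)%E (@cons_tuple R n @^-1` C)).
rewrite (_ : _ @^-1` _ = `[(- r), r]%classic `*`
  [set t : n.-tuple RT | forall i, tnth t i \in `[(- r), r]]); last first.
  apply/seteqP; split => [[s t] /= h|[s t] /= [hs ht] i].
    split; first by have := h ord0; rewrite tnth0.
    by move=> i; have := h (lift ord0 i); rewrite tnthS.
  by case: (unliftP ord0 i) => [j|] ->; rewrite ?tnthS ?tnth0.
rewrite product_measure1E//; last exact: (measurable_tuple_box (fun=> `[(- r), r])).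
have lr : lambda `[(- r), r]%classic = (2 * r)%:E.
  by rewrite lebesgue_measure_itv/= lte_fin ifT -?EFinD; [congr _%:E|]; lra.
by rewrite IH exprS EFinM -lr.
Qed.

Lemma lebesgue_ballT_fin n : (lebesgue_tuple n (ballT (0 : 'rV[R]_n) 1) < +oo)%E.
Proof.
apply: (@le_lt_trans _ _ (lebesgue_tuple n
    [set t : n.-tuple RT | forall i, tnth t i \in `[(- 1), 1]])).
  apply: le_measure; rewrite ?inE; first exact: measurable_ballT.
    exact: (measurable_tuple_box (fun=> `[(- 1), 1])).
  move=> t /= ht i; rewrite in_itv/= -ler_norml.
  apply: le_trans ht; rewrite subr0; have := abs_coord_le_enorm (vec t) i.
  by rewrite mxE.
by rewrite lebesgue_tuple_cube// ltry.
Qed.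

(** The cube of half-side 1 / (n + 1) lies in the unit ball, by [enorm_le_mxnorm]. Positivity makes
    the division by the volume in [ball_mean] legitimate. *)
Lemma lebesgue_ballT_gt0 n : (0 < lebesgue_tuple n (ballT (0 : 'rV[R]_n) 1))%E.
Proof.
have r0 : 0 < n.+1%:R^-1 :> R by rewrite invr_gt0.
apply: (@lt_le_trans _ _ (lebesgue_tuple n
    [set t : n.-tuple RT | forall i, tnth t i \in `[(- n.+1%:R^-1), n.+1%:R^-1]])).
  by rewrite lebesgue_tuple_cube// lte_fin exprn_gt0// mulr_gt0.
apply: le_measure; rewrite ?inE; last first.
- move=> t /= ht; rewrite /ballT/cball/= subr0.
  apply: le_trans (enorm_le_mxnorm _) _; rewrite mulrC -ler_pdivlMr// mul1r.
  apply: mxnorm_le; first exact: ltW.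
  by move=> i j; rewrite mxE ler_norml; exact: ht.
- exact: measurable_ballT.
- exact: (measurable_tuple_box (fun=> `[(- n.+1%:R^-1), n.+1%:R^-1])).
Qed.

Definition ball_vol n : R := fine (lebesgue_tuple n (ballT (0 : 'rV[R]_n) 1)).

Lemma ball_volE n : (ball_vol n)%:E = lebesgue_tuple n (ballT (0 : 'rV[R]_n) 1).
Proof. by rewrite fineK// ge0_fin_numE// lebesgue_ballT_fin. Qed.

Lemma ball_vol_gt0 n : 0 < ball_vol n.
Proof. by rewrite -lte_fin ball_volE lebesgue_ballT_gt0. Qed.

Lemma vec_affine_tuple n c (a : 'rV[R]_n) (t : n.-tuple RT) :
  vec (affine_tuple c (a 0) t) = c *: vec t + a.
Proof. by apply/rowP => i; rewrite !mxE tnth_mktuple. Qed.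

Lemma lebesgue_ballT n (a : 'rV[R]_n) r : 0 < r ->
  lebesgue_tuple n (ballT a r) = (r ^+ n * ball_vol n)%:E.
Proof.
move=> r0; rewrite -(@lebesgue_tuple_affine _ _ r (a 0))//; last first.
  exact: measurable_ballT.
rewrite EFinM ball_volE; congr (_ * lebesgue_tuple n _)%E.
apply/seteqP; split => t; rewrite /ballT/cball/= vec_affine_tuple addrK subr0;
  by rewrite enormZ gtr0_norm// ger_pMr.
Qed.

Lemma bernoulli k (r : R) : 0 <= r -> r <= 1 -> 1 - r ^+ k <= k%:R * (1 - r).
Proof.
move=> r0 r1; elim: k => [|k IH]; first by rewrite expr0 mul0r subrr.
rewrite exprS -natr1 mulrDl mul1r.
have rk1 : r ^+ k <= 1 by rewrite exprn_ile1.
have : 0 <= (1 - r ^+ k) * (1 - r) by rewrite mulr_ge0 ?subr_ge0.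
move: IH; move: (r ^+ k) (k%:R * _) => z w; lra.
Qed.

(** The ball of radius 1 - |a - b| around a lies inside the unit ball around b, so the difference
    sits in a shell of relative volume 1 - (1 - |a - b|)^n, at most n |a - b| by Bernoulli's
    inequality. *)
Lemma lebesgue_ballT_setD n (a b : 'rV[R]_n) : enorm (a - b) < 1 ->
  (lebesgue_tuple n (ballT a 1 `\` ballT b 1)
   <= (n%:R * enorm (a - b) * ball_vol n)%:E)%E.
Proof.
move=> ab; set r := 1 - enorm (a - b).
have r0 : 0 < r by rewrite subr_gt0.
have rle1 : r <= 1 by rewrite gerBl enorm_ge0.
apply: (@le_trans _ _ (lebesgue_tuple n (ballT a 1 `\` ballT a r))).
  apply: le_measure; rewrite ?inE; try by apply: measurableD; exact: measurable_ballT.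
  move=> t [ta tb]; split=> //= tr; apply: tb; rewrite /ballT/cball/=.
  have := enormB_le (vec t) a b; move: tr; rewrite /ballT/cball/= /r; lra.
rewrite measureD; try exact: measurable_ballT; last first.
  by rewrite /= lebesgue_ballT// ltry.
rewrite setIidr; last by move=> t; rewrite /ballT/cball/= => /le_trans; apply.
rewrite [X in (X - _)%E](lebesgue_ballT a ltr01).
rewrite [X in (_ - X)%E](lebesgue_ballT a r0).
rewrite -EFinB lee_fin expr1n -mulrBl ler_pM2r ?ball_vol_gt0//.
by rewrite (le_trans (bernoulli n (ltW r0) rle1))// /r opprB addrC subrK.
Qed.

End LebesgueBalls.

(** * Differentiability from second differences *)

Section Frechet.
Context {R : realType}.

(** One epsilon-delta estimate in Euclidean norm yields both differentiability and the value of the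
    Jacobian; conversely it unpacks them. *)
Lemma frechetP n m (F : 'rV[R]_n -> 'rV[R]_m) x (A : 'M[R]_(n, m)) :
  (forall e, 0 < e -> exists2 d, 0 < d &
     forall h, enorm h < d -> enorm (F (x + h) - F x - h *m A) <= e * enorm h)
  <-> differentiable F x /\ jacobian F x = A.
Proof.
split=> [FA|[dF <-] e e0]; last first.
  have /diff_locally/eqaddoP/= /(_ (e / m.+1%:R)) := dF.
  move=> /(_ (divr_gt0 e0 (ltr0Sn _ _)))/nbhs_enormP[d d0 dd].
  exists d => // h hd; rewrite /jacobian mul_rV_lin1.
  apply: le_trans (enorm_le_mxnorm _) _.
  rewrite mulrC -ler_pdivlMr// mulrAC.
  have hd' : enorm (h - 0) < d by rewrite subr0.
  have := dd h hd'; rewrite /= /shift/= /cst/= !fctE (addrC h) opprD addrA.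
  move=> /le_trans; apply; rewrite ler_wpM2l ?divr_ge0 ?(ltW e0)//.
  exact: mxnorm_le_enorm.
pose df : {linear 'rV[R]_n -> 'rV[R]_m} := mulmxr A.
have dfc : continuous df.
  have bd (v : 'rV[R]_n) : enorm (df v) <= opnorm A^T * enorm v.
    by have := enorm_mulmx_le A^T v; rewrite trmxK.
  move=> u; apply/(@cvg_enormP _ _ _ (nbhs u)) => e e0; apply/nbhs_enormP.
  exists (e / (opnorm A^T + 1)) => [|v].
    by rewrite divr_gt0// ltr_wpDl// opnorm_ge0.
  rewrite ltr_pdivlMr; last by rewrite ltr_wpDl// opnorm_ge0.
  rewrite -linearB => h; apply: le_lt_trans (bd _) _; apply: le_lt_trans h.
  by rewrite mulrC ler_wpM2l ?enorm_ge0// lerDl.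
have near_le e : 0 < e ->
    \forall h \near (0 : 'rV[R]_n), `|F (h + x) - (F x + df h)| <= e * `|h|.
  move=> e0; have [d d0 dd] := FA (e / n.+1%:R) (divr_gt0 e0 (ltr0Sn _ _)).
  apply/nbhs_enormP; exists d => // h; rewrite subr0 => hd.
  rewrite (addrC h) opprD addrA.
  apply: le_trans (mxnorm_le_enorm _) _; apply: le_trans (dd _ hd) _.
  rewrite -mulrA ler_wpM2l// ?(ltW e0)// mulrC ler_pdivrMr// mulrC.
  exact: enorm_le_mxnorm.
have dE : 'd F x = df :> ('rV[R]_n -> 'rV[R]_m).
  by apply: diff_unique => //; apply/eqaddoP => e; exact: near_le.
split; first by apply/diff_locallyP; rewrite dE; split => //;
  apply/eqaddoP => e; exact: near_le.
by apply/row_matrixP => i; rewrite !rowE /jacobian mul_rV_lin1 dE.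
Qed.

End Frechet.

(** * Almost additive functions are linear up to a quadratic remainder *)

Section SecondDifference.
Context {R : realType}.

(* The slope p is any cluster point of g s / s as s -> 0+: for s much smaller
   than t, g t is close to truncn (t / s) times g s. *)
Lemma approx_additive1 (g : R -> R) (r C M : R) : 0 <= C -> 0 <= M -> 0 < r ->
  (forall s t, `|s| + `|t| < r -> `|g (s + t) - g s - g t| <= C * `|s| * `|t|) ->
  (forall t, `|t| < r -> `|g t| <= M * `|t|) ->
  exists p, forall t, 2 * `|t| < r -> `|g t - p * t| <= 2 * C * t ^+ 2.
Proof.
move=> C0 M0 r0 ga gM.
have g0 : g 0 = 0.
  by apply/eqP; rewrite -normr_le0; have := gM 0; rewrite normr0 mulr0; apply.
(* Adding s to k s costs at most C (k s) s, and these defects add up to at most C (k s)^2. *)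
have gm s k : 0 < s -> k%:R * s < r ->
    `|g (k%:R * s) - k%:R * g s| <= C * (k%:R * s) ^+ 2.
  move=> s0; elim: k => [|k IH] ks.
    by rewrite !mul0r g0 subr0 normr0 expr0n mulr0.
  have k0 : 0 <= k%:R :> R by [].
  move: ks; rewrite -natr1 mulrDl mul1r => ks.
  have ksr : k%:R * s < r by lra.
  have ks0 : 0 <= k%:R * s by rewrite mulr_ge0// ltW.
  have := ga (k%:R * s) s; rewrite (ger0_norm ks0) (gtr0_norm s0).
  move=> /(_ ks) h1; have h2 := IH ksr.
  rewrite (_ : _ - _ = (g (k%:R * s + s) - g (k%:R * s) - g s)
      + (g (k%:R * s) - k%:R * g s)); last by ring.
  apply: le_trans (ler_normD _ _) _; apply: le_trans (lerD h1 h2) _.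
  have : 0 <= C * (k%:R * s * s) by rewrite !mulr_ge0// ltW.
  have : 0 <= C * (s * s) by rewrite !mulr_ge0// ltW.
  move: (k%:R : R) => z; lra.
(* With k the integer part of t / s, the term C t s comes from splitting off the leftover q = t - k
   s; one M s bounds g q, the other the rounding of t / s to k. *)
have gq s t : 0 < s -> s <= t -> t < r ->
    `|g t - t * (g s / s)| <= C * t ^+ 2 + C * t * s + 2 * M * s.
  move=> s0 st tr; have t0 := lt_le_trans s0 st.
  pose k := Num.truncn (t / s).
  have /andP[kt tk] : k%:R <= t / s < k.+1%:R.
    by apply: truncn_itv; rewrite divr_ge0// ltW.
  move: kt tk; rewrite ler_pdivlMr// ltr_pdivrMr// -natr1 mulrDl mul1r => kt tk.
  have ks0 : 0 <= k%:R * s by rewrite mulr_ge0// ltW.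
  have h1 := gm s k s0 (le_lt_trans kt tr).
  have sM : `|g s| <= M * s.
    by have := gM s; rewrite (gtr0_norm s0); apply; lra.
  set q := t - k%:R * s.
  have q0 : 0 <= q by rewrite /q; lra.
  have qs : q <= s by rewrite /q; lra.
  have qM : `|g q| <= M * s.
    have := gM q; rewrite (ger0_norm q0) => /(_ (le_lt_trans qs (le_lt_trans st tr))).
    by move=> /le_trans; apply; rewrite ler_wpM2l.
  have h2 : `|g t - g (k%:R * s) - g q| <= C * t * s.
    have := ga (k%:R * s) q; rewrite (ger0_norm ks0) (ger0_norm q0) addrC subrK.
    move=> /(_ tr) /le_trans; apply.
    by apply: ler_pM => //; [exact: mulr_ge0|exact: ler_wpM2l].
  have h3 : `|(k%:R - t / s) * g s| <= M * s.
    rewrite normrM; apply: le_trans sM; rewrite ler_piMl//.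
    rewrite ler_norml; have : t / s - k%:R = q / s.
      by rewrite /q mulrBl mulfK// gt_eqF.
    have : q / s <= 1 by rewrite ler_pdivrMr// mul1r.
    have : 0 <= q / s by rewrite divr_ge0// ltW.
    move: (t / s) (q / s) (k%:R : R) => ? ? ?; lra.
  rewrite (_ : _ - _ = (g t - g (k%:R * s) - g q)
    + (g (k%:R * s) - k%:R * g s) + (g q + (k%:R - t / s) * g s)); last by field; lra.
  apply: le_trans (ler_normD _ _) _.
  have h4 : `|g q + (k%:R - t / s) * g s| <= 2 * M * s.
    apply: le_trans (ler_normD _ _) _; apply: le_trans (lerD qM h3) _; lra.
  have h5 : C * (k%:R * s) ^+ 2 <= C * t ^+ 2.
    by rewrite ler_wpM2l// ler_sqr ?nnegrE// ltW.
  apply: lerD h4; apply: le_trans (ler_normD _ _) _.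
  rewrite addrC lerD//; exact: le_trans h1 h5.
(* The quotients g s / s stay in [-M, M] for small s > 0, so compactness provides a cluster point p;
   their convergence is not known at this stage. *)
pose F := (fun s : R => g s / s) @ 0^'+.
have [p [_ clp]] : exists p, `[(- M), M]%classic p /\ cluster F p.
  have [|p [? ?]] := @segment_compact _ (- M) M F; last by exists p.
  change (\forall s \near 0^'+, `[- M, M]%classic (g s / s)).
  near=> s; rewrite /= in_itv/= -ler_norml normrM normfV.
  have s0 : 0 < s by [].
  rewrite ler_pdivrMr ?normr_gt0 ?gt_eqF//; apply: gM.
  by rewrite gtr0_norm.
have clP e : 0 < e -> exists s, [/\ 0 < s, s < e & `|g s / s - p| < e].
  move=> e0; have := clp ((fun s => g s / s) @` [set s | 0 < s < e]) (ball p e).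
  case => //.
  - change (\forall s \near 0^'+,
      ((fun s => g s / s) @` [set s | 0 < s < e]) (g s / s)).
    by near=> s; exists s => //; apply/andP; split.
  - exact: nbhsx_ballx.
  - move=> _ [[s /= /andP[s0 se] <-]]; rewrite /ball/= => spe.
    by exists s; split => //; rewrite distrC.
have gp t : 0 < t -> t < r -> `|g t - p * t| <= C * t ^+ 2.
  move=> t0 tr; apply/ler_addgt0Pr => e e0.
  (* Chosen so that s < e / K and |g s / s - p| < e / K together contribute at most e to the
     error. *)
  pose K := C * t + 2 * M + t.
  have K0 : 0 < K by rewrite /K; have := mulr_ge0 C0 (ltW t0); lra.
  have [s [s0 se sp]] := clP (Num.min t (e / K)) ltac:(by rewrite lt_min t0 divr_gt0).
  move: se sp; rewrite !lt_min => /andP[st se] /andP[_ sp].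
  rewrite (_ : _ - _ = (g t - t * (g s / s)) + t * (g s / s - p)); last by ring.
  apply: le_trans (ler_normD _ _) _; rewrite normrM (gtr0_norm t0).
  have h1 := gq s t s0 (ltW st) tr.
  have h2 : t * `|g s / s - p| <= t * (e / K) by rewrite ler_wpM2l ?ltW.
  apply: le_trans (lerD h1 h2) _; rewrite -addrA -addrA lerD2l.
  have hK : (C * t + 2 * M + t) * (e / K) = e by rewrite mulrC divfK// gt_eqF.
  have h3 : (C * t + 2 * M) * s <= (C * t + 2 * M) * (e / K).
    by apply: ler_wpM2l; [have := mulr_ge0 C0 (ltW t0); lra|exact: ltW].
  move: hK h3; move: (e / K) => z; lra.
exists p => t tr.
have t2 : 0 <= C * t ^+ 2 by rewrite mulr_ge0// sqr_ge0.
have [t0|t0|->] := ltgtP t 0; last first.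
- by rewrite g0 mulr0 subr0 normr0 expr0n mulr0.
- apply: le_trans (gp t t0 _) _; last lra.
  by move: tr; rewrite gtr0_norm//; lra.
(* For t < 0, g t is compared with - g (- t), at the cost of one more C t^2: hence the factor 2 in
   the conclusion. *)
have h2 : `|0 - g t - g (- t)| <= C * t ^+ 2.
  rewrite -{1}g0 -(subrr t) (le_trans (ga _ _ _))//; first by rewrite normrN; lra.
  by rewrite normrN -mulrA -normrM ger0_norm// -expr2 sqr_ge0.
have h3 : `|g (- t) - p * - t| <= C * t ^+ 2.
  by rewrite -(sqrrN t); apply: gp; move: tr; rewrite ltr0_norm//; lra.
rewrite (_ : _ - _ = - (0 - g t - g (- t)) - (g (- t) - p * - t)); last by ring.
apply: le_trans (ler_normB _ _) _; rewrite normrN.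
by apply: le_trans (lerD h2 h3) _; lra.
Unshelve. all: by end_near. Qed.

(** Splitting h along the coordinate axes costs a quadratic error, and [approx_additive1] handles
    each axis. *)
Lemma approx_additive n (G : 'rV[R]_n -> R) (r C M : R) :
  0 <= C -> 0 <= M -> 0 < r ->
  (forall h w, enorm h + enorm w < r ->
     `|G (h + w) - G h - G w| <= C * enorm h * enorm w) ->
  (forall h, enorm h < r -> `|G h| <= M * enorm h) ->
  exists p K, exists2 r', 0 < r' & forall h, enorm h < r' ->
    `|G h - dot p h| <= K * enorm h ^+ 2.
Proof.
move=> C0 M0 r0 Ga GM.
have G0 : G 0 = 0.
  apply/eqP; rewrite -normr_le0; have := GM 0.
  by rewrite enorm0 mulr0; apply.
pose e j : 'rV[R]_n := delta_mx 0 j.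
have e1 j : enorm (e j) = 1.
  by rewrite enormE dot_delta mxE !eqxx sqrtr1.
have eZ a j : enorm (a *: e j) = `|a| by rewrite enormZ e1 mulr1.
have hp j : exists p, forall t, 2 * `|t| < r ->
    `|G (t *: e j) - p * t| <= 2 * C * t ^+ 2.
  apply: (@approx_additive1 (fun t => G (t *: e j)) r C M) => // [s t st|t tr].
    by rewrite scalerDl; have := Ga (s *: e j) (t *: e j); rewrite !eZ; apply.
  by have := GM (t *: e j); rewrite eZ; apply.
pose p : 'rV[R]_n := \row_j projT1 (cid (hp j)).
have pP j t : 2 * `|t| < r -> `|G (t *: e j) - p 0 j * t| <= 2 * C * t ^+ 2.
  by move=> tr; rewrite mxE; exact: (projT2 (cid (hp j))).
have split_sum (h : 'rV[R]_n) (s : seq 'I_n) : \sum_(j <- s) `|h 0 j| < r ->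
    `|G (\sum_(j <- s) h 0 j *: e j) - \sum_(j <- s) G (h 0 j *: e j)|
    <= C * (\sum_(j <- s) `|h 0 j|) ^+ 2.
  elim: s => [|j s IH]; first by rewrite !big_nil G0 subr0 normr0 expr0n mulr0.
  rewrite !big_cons; set S := \sum_(i <- s) `|_|; set w := \sum_(i <- s) _ *: _.
  set T := \sum_(i <- s) G _; move=> hr.
  have S0 : 0 <= S by exact: sumr_ge0.
  have wS : enorm w <= S.
    rewrite (le_trans (enorm_sum _ _ _))//.
    by rewrite le_eqVlt; apply/orP; left; apply/eqP/eq_bigr => i _; rewrite eZ.
  have a0 := normr_ge0 (h 0 j).
  have h1 := Ga (h 0 j *: e j) w; rewrite eZ in h1.
  have {}h1 := h1 (le_lt_trans (lerD (lexx _) wS) hr).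
  have h2 : `|G w - T| <= C * S ^+ 2 by apply: IH; rewrite -/S; lra.
  rewrite (_ : _ - _ = (G (h 0 j *: e j + w) - G (h 0 j *: e j) - G w)
    + (G w - T)); last by ring.
  apply: le_trans (ler_normD _ _) _; apply: le_trans (lerD h1 h2) _.
  have : C * `|h 0 j| * enorm w <= C * `|h 0 j| * S.
    by rewrite ler_wpM2l// mulr_ge0.
  have : 0 <= C * `|h 0 j| * S by rewrite !mulr_ge0.
  have : 0 <= C * `|h 0 j| ^+ 2 by rewrite !mulr_ge0.
  move: (`|h 0 j|) => a; lra.
(* The radius gives 2 (n + 1) |h| < r, enough both for the splitting, where the sum of the |h_j| is
   at most n |h|, and for the axes, which ask 2 |h_j| < r. In the constant, C n^2 comes from the
   splitting and 2 C n from the n axes. *)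
exists p, (C * n%:R ^+ 2 + 2 * C * n%:R), (r / (2 * n.+1%:R)).
  by rewrite divr_gt0// mulr_gt0.
move=> h; rewrite ltr_pdivlMr ?mulr_gt0// => hr.
have h0 := enorm_ge0 h.
have nh0 : 0 <= n%:R * enorm h by rewrite mulr_ge0.
have hr' : 2 * (n%:R * enorm h) + 2 * enorm h < r.
  by move: hr; rewrite -natr1; lra.
have Sn : \sum_(j <- index_enum 'I_n) `|h 0 j| <= n%:R * enorm h.
  apply: (@le_trans _ _ (\sum_(j < n) enorm h)).
    by apply: ler_sum => j _; exact: abs_coord_le_enorm.
  by rewrite sumr_const card_ord mulr_natl.
have Sr : \sum_(j <- index_enum 'I_n) `|h 0 j| < r by lra.
have h1 := split_sum h _ Sr.
have hE : \sum_(j <- index_enum 'I_n) h 0 j *: e j = h by rewrite -row_sum_delta.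
rewrite hE in h1.
have h2 : `|\sum_(j <- index_enum 'I_n) G (h 0 j *: e j) - dot p h|
    <= 2 * C * n%:R * enorm h ^+ 2.
  rewrite /dot -sumrB; apply: le_trans (ler_norm_sum _ _ _) _.
  apply: (@le_trans _ _ (\sum_(j < n) 2 * C * enorm h ^+ 2)).
    apply: ler_sum => j _; have hj := abs_coord_le_enorm h j.
    apply: le_trans (pP j _ _) _; first by lra.
    rewrite ler_wpM2l ?mulr_ge0// -real_normK ?num_real//.
    by rewrite lerXn2r ?nnegrE.
  rewrite sumr_const card_ord -mulr_natl; lra.
rewrite -[X in `|X|](subrKA (\sum_(j <- index_enum 'I_n) G (h 0 j *: e j))).
apply: le_trans (ler_normD _ _) _; rewrite mulrDl; apply: lerD h2.
apply: le_trans h1 _; rewrite -mulrA ler_wpM2l// -exprMn lerXn2r ?nnegrE//.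
exact: sumr_ge0.
Qed.

End SecondDifference.

(** * Ball means of Lipschitz functions *)

Section BallMean.
Context {R : realType}.
Local Notation RT := (measurableTypeR R).
Local Notation mu := (lebesgue_tuple _).

Lemma ball_meanE n (h : 'rV[R]_n -> R) : ball_mean h =
  (\int[lebesgue_tuple n]_(t in ballT 0 1) h (vec t)) / ball_vol n.
Proof. by rewrite /ball_mean /ball_vol /ballT unit_ballE. Qed.

Lemma lebesgue_ballT_lty n (a : 'rV[R]_n) :
  (lebesgue_tuple n (ballT a 1) < +oo)%E.
Proof. by rewrite lebesgue_ballT// ltry. Qed.

Lemma Rintegral_translate n (a : 'rV[R]_n) (f : 'rV[R]_n -> R) :
  measurable_fun (ballT a 1) (f \o @vec R n) ->
  (lebesgue_tuple n).-integrable (ballT 0 1) (EFin \o (fun t => f (vec t + a))) ->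
  \int[lebesgue_tuple n]_(t in ballT 0 1) f (vec t + a) =
  \int[lebesgue_tuple n]_(t in ballT a 1) f (vec t).
Proof.
move=> mf intf; rewrite /Rintegral; congr fine.
pose phi := affine_tuple 1 (a 0) : n.-tuple RT -> n.-tuple RT.
have mphi : measurable_fun setT phi by exact: measurable_affine_tuple.
have phiE t : vec (phi t) = vec t + a.
  by rewrite /phi vec_affine_tuple scale1r.
have preB : phi @^-1` ballT a 1 = ballT 0 1.
  by apply/seteqP; split => t; rewrite /ballT/cball/= phiE addrK subr0.
(* Only measurability on the ball is available; extending by 0 gives a function measurable
   everywhere, to which the pushforward formula applies. *)
pose g := (EFin \o (f \o @vec R n)) \_ (ballT a 1).
have mB := measurable_ballT a 1.
have mg : measurable_fun setT g.
  by apply/(measurable_restrictT _ mB)/measurable_EFinP.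
have gphi t : ballT 0 1 t -> g (phi t) = (f (vec t + a))%:E.
  move=> Bt; rewrite /g patchE mem_set/= ?phiE//.
  by rewrite -[ballT a 1 _]/((phi @^-1` ballT a 1) t) preB.
transitivity (\int[lebesgue_tuple n]_(t in phi @^-1` ballT a 1) (g \o phi) t)%E.
  by rewrite preB; apply: eq_integral => t /set_mem Bt; rewrite /= gphi.
rewrite -(integral_pushforward mphi)//; last first.
  rewrite preB; apply: eq_integrable intf => //; first exact: measurable_ballT.
  by move=> t /set_mem Bt; rewrite /= gphi.
transitivity (\int[lebesgue_tuple n]_(t in ballT a 1) g t)%E.
  apply: eq_measure_integral => A mA _.
  have := @lebesgue_tuple_affine R n 1 (a 0) A ltr01 mA.
  by rewrite expr1n mul1e.
by apply: eq_integral => t /set_mem Bt; rewrite /g patchE mem_set.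
Qed.

(** The integrals over the intersection cancel. Each of the two remaining crescents has measure at
    most n |a - b| times the volume of the unit ball, whence the factor 2. *)
Lemma Rintegral_ballT_diff n (a b : 'rV[R]_n) (f : 'rV[R]_n -> R) M :
  0 <= M -> enorm (a - b) < 1 ->
  (forall t, (ballT a 1 `|` ballT b 1) t -> `|f (vec t)| <= M) ->
  measurable_fun (ballT a 1 `|` ballT b 1) (f \o @vec R n) ->
  `|\int[lebesgue_tuple n]_(t in ballT a 1) f (vec t) -
    \int[lebesgue_tuple n]_(t in ballT b 1) f (vec t)|
  <= 2 * n%:R * enorm (a - b) * ball_vol n * M.
Proof.
move=> M0 ab fM mf.
pose A := ballT a 1; pose B := ballT b 1.
have mA : measurable A := measurable_ballT a 1.
have mB : measurable B := measurable_ballT b 1.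
have ifS S : measurable S -> S `<=` A `|` B -> (lebesgue_tuple n S < +oo)%E ->
    (lebesgue_tuple n).-integrable S (EFin \o (f \o @vec R n)).
  move=> mS SAB Soo; apply: measurable_bounded_integrable => //.
    by apply: measurable_funS mf => //; exact: measurableU.
  exists M; split; first exact: num_real.
  by move=> z Mz t /SAB ABt; apply: (le_trans (fM t ABt)); exact: ltW.
have bound c c' : (c = a /\ c' = b) \/ (c = b /\ c' = a) -> enorm (c - c') < 1 ->
    `|\int[lebesgue_tuple n]_(t in ballT c 1 `\` ballT c' 1) f (vec t)|
    <= n%:R * enorm (c - c') * ball_vol n * M.
  move=> cab cc'.
  have mD : measurable (ballT c 1 `\` ballT c' 1).
    by apply: measurableD; exact: measurable_ballT.
  have DAB : ballT c 1 `\` ballT c' 1 `<=` A `|` B.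
    by move=> t [ct _]; case: cab ct => -[-> _] ct; [left|right].
  have Dle := lebesgue_ballT_setD cc'.
  have Dfin := le_lt_trans Dle (ltry _).
  apply: le_trans (le_normr_Rintegral mD (ifS _ mD DAB Dfin)) _.
  apply: (@le_trans _ _
      (\int[lebesgue_tuple n]_(t in ballT c 1 `\` ballT c' 1) M)).
    apply: le_Rintegral => //.
    - have := ifS _ mD DAB Dfin.
      by move=> /integrable_abse; apply: eq_integrable.
    - exact: (measurable_bounded_integrable mD Dfin (measurable_cst _) (bounded_cst _ _)).
    - by move=> t /DAB; exact: fM.
  rewrite Rintegral_cst// mulrC ler_wpM2r//.
  rewrite -lee_fin fineK//.
  by rewrite ge0_fin_numE.
have split c c' : (c = a /\ c' = b) \/ (c = b /\ c' = a) ->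
    \int[lebesgue_tuple n]_(t in ballT c 1) f (vec t) =
    \int[lebesgue_tuple n]_(t in ballT c 1 `\` ballT c' 1) f (vec t) +
    \int[lebesgue_tuple n]_(t in ballT c 1 `&` ballT c' 1) f (vec t).
  move=> cab; rewrite -{1}(setUIDK (ballT c 1) (ballT c' 1)).
  rewrite Rintegral_setU; first by rewrite addrC.
  - by apply: measurableI; exact: measurable_ballT.
  - by apply: measurableD; exact: measurable_ballT.
  - rewrite setUIDK; apply: ifS; [exact: measurable_ballT| |exact: lebesgue_ballT_lty].
    by case: cab => -[-> _] t ct; [left|right].
  - by apply/disj_setPS => t [[_ ?] [_ ?]].
rewrite (split a b); last by left.
rewrite (split b a); last by right.
rewrite (setIC (ballT b 1) (ballT a 1)).
have ba : enorm (b - a) < 1 by rewrite enormBC.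
have h1 := bound a b (or_introl (conj erefl erefl)) ab.
have h2 := bound b a (or_intror (conj erefl erefl)) ba.
move: h1 h2; rewrite (enormBC b).
move: (Rintegral _ _ _) (Rintegral _ _ _) (Rintegral _ _ _) => u w v h1 h2.
rewrite (_ : _ - _ = v - w); last by ring.
apply: le_trans (ler_normB _ _) _; apply: le_trans (lerD h1 h2) _; lra.
Qed.

Definition ball_integrable n (k : 'rV[R]_n -> R) :=
  (lebesgue_tuple n).-integrable (ballT 0 1) (EFin \o (fun t => k (vec t))).

Lemma ball_integrable_cst n (c : R) : ball_integrable (fun _ : 'rV[R]_n => c).
Proof.
apply: (measurable_bounded_integrable (measurable_ballT _ _)).
- exact: lebesgue_ballT_lty.
- exact: measurable_cst.
- exact: bounded_cst.
Qed.

Lemma ball_integrableB n (k l : 'rV[R]_n -> R) :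
  ball_integrable k -> ball_integrable l ->
  ball_integrable (fun xi => k xi - l xi).
Proof.
move=> ik il; have := integrableB (measurable_ballT _ _) ik il.
by apply: eq_integrable => //; exact: measurable_ballT.
Qed.

Lemma ball_integrableD n (k l : 'rV[R]_n -> R) :
  ball_integrable k -> ball_integrable l ->
  ball_integrable (fun xi => k xi + l xi).
Proof.
move=> ik il; have := integrableD (measurable_ballT _ _) ik il.
by apply: eq_integrable => //; exact: measurable_ballT.
Qed.

Lemma ball_integrableZ n c (k : 'rV[R]_n -> R) :
  ball_integrable k -> ball_integrable (fun xi => c * k xi).
Proof.
move=> ik; have := integrableZl (measurable_ballT _ _) c ik.
by apply: eq_integrable => //; exact: measurable_ballT.
Qed.

Lemma ball_integrable_sum n I (s : seq I) (k : I -> 'rV[R]_n -> R) :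
  (forall i, ball_integrable (k i)) ->
  ball_integrable (fun xi => \sum_(i <- s) k i xi).
Proof.
move=> ik; elim: s => [|i s IH].
  by under eq_fun do rewrite big_nil; exact: ball_integrable_cst.
by under eq_fun do rewrite big_cons; exact: ball_integrableD.
Qed.

Lemma ball_mean_cst n (c : R) : ball_mean (fun _ : 'rV[R]_n => c) = c.
Proof.
rewrite ball_meanE Rintegral_cst; last exact: measurable_ballT.
by rewrite mulfK// gt_eqF// ball_vol_gt0.
Qed.

Lemma ball_meanB n (k l : 'rV[R]_n -> R) :
  ball_integrable k -> ball_integrable l ->
  ball_mean (fun xi => k xi - l xi) = ball_mean k - ball_mean l.
Proof.
move=> ik il; rewrite !ball_meanE -mulrBl RintegralB//.
exact: measurable_ballT.
Qed.

Lemma ball_meanD n (k l : 'rV[R]_n -> R) :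
  ball_integrable k -> ball_integrable l ->
  ball_mean (fun xi => k xi + l xi) = ball_mean k + ball_mean l.
Proof.
move=> ik il; rewrite !ball_meanE -mulrDl RintegralD//.
exact: measurable_ballT.
Qed.

Lemma ball_meanZ n c (k : 'rV[R]_n -> R) :
  ball_integrable k -> ball_mean (fun xi => c * k xi) = c * ball_mean k.
Proof.
move=> ik; rewrite !ball_meanE RintegralZl ?mulrA//.
exact: measurable_ballT.
Qed.

Lemma ball_mean_sum n I (s : seq I) (k : I -> 'rV[R]_n -> R) :
  (forall i, ball_integrable (k i)) ->
  ball_mean (fun xi => \sum_(i <- s) k i xi) = \sum_(i <- s) ball_mean (k i).
Proof.
move=> ik; elim: s => [|i s IH].
  by under eq_fun do rewrite big_nil; rewrite big_nil ball_mean_cst.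
under eq_fun do rewrite big_cons; rewrite ball_meanD ?big_cons ?IH//.
exact: ball_integrable_sum.
Qed.

Lemma le_ball_mean n (k l : 'rV[R]_n -> R) :
  ball_integrable k -> ball_integrable l ->
  (forall xi, enorm xi <= 1 -> k xi <= l xi) -> ball_mean k <= ball_mean l.
Proof.
move=> ik il kl; rewrite !ball_meanE ler_pM2r ?invr_gt0 ?ball_vol_gt0//.
apply: le_Rintegral => // [|t]; first exact: measurable_ballT.
by rewrite /ballT/cball/= subr0; exact: kl.
Qed.

(** * Increments of the ball mean of a Lipschitz function *)

Section LipschitzMean.
Context n (f : 'rV[R]_n -> R) (x : 'rV[R]_n) (d rho Lf : R).
Hypotheses (d0 : 0 < d) (rho0 : 0 < rho) (Lf0 : 0 <= Lf).
(** Large enough to contain x + h + d xi for all |h| < rho and |xi| <= 1, so that increments of [F]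
    see f only where it is Lipschitz. *)
Let O : set 'rV[R]_n := [set s | enorm (s - x) < d + rho].
Hypothesis fL : forall s t, O s -> O t -> `|f s - f t| <= Lf * enorm (s - t).

Let F u := ball_mean (fun xi => f (u + d *: xi)).

Lemma measurable_lip_affine (c : 'rV[R]_n) S : measurable S ->
  (forall t, S t -> O (c + d *: vec t)) ->
  measurable_fun S (fun t : n.-tuple RT => f (c + d *: vec t)).
Proof.
move=> mS SO; pose O' : set 'rV[R]_n := [set xi | O (c + d *: xi)].
have oO' : open O'.
  rewrite openE => xi Oxi; apply/nbhs_enormP.
  exists ((d + rho - enorm (c + d *: xi - x)) / d).
    by rewrite divr_gt0// subr_gt0.
  move=> s; rewrite ltr_pdivlMr// ltrBrDr => h; rewrite /O'/O/=.
  apply: le_lt_trans h; rewrite [X in enorm X](_ : _ =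
    d *: (s - xi) + (c + d *: xi - x)).
    by rewrite (le_trans (enormD _ _))// enormZ gtr0_norm// mulrC.
  by apply/rowP => i; rewrite !mxE; ring.
apply: (@measurable_funS _ _ _ _ (@vec R n @^-1` O')) => //.
  exact: measurable_vec_open.
apply: (measurable_fun_vec (f := fun xi => f (c + d *: xi)) oO').
move=> xi /set_mem Oxi; apply/(@cvgrPdist_lt _ _ _ (nbhs xi)) => e e0.
have K0 : 0 < Lf * d + 1 by rewrite ltr_wpDl// mulr_ge0// ltW.
have : nbhs xi O' by exact: open_nbhs_nbhs.
move=> /nbhs_enormP[r r0 rO']; apply/nbhs_enormP.
exists (Num.min r (e / (Lf * d + 1))); first by rewrite lt_min r0 divr_gt0.
move=> s; rewrite lt_min => /andP[sr]; rewrite ltr_pdivlMr// => se.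
apply: le_lt_trans (fL Oxi (rO' _ sr)) _; apply: le_lt_trans se.
rewrite opprD addrACA subrr add0r -scalerBr enormZ gtr0_norm// enormBC.
by have := enorm_ge0 (s - xi); move: (enorm _) => z; lra.
Qed.

Lemma integrable_lip_affine (c : 'rV[R]_n) S : measurable S ->
  (lebesgue_tuple n S < +oo)%E ->
  (forall t, S t -> O (c + d *: vec t)) ->
  (lebesgue_tuple n).-integrable S
    (EFin \o (fun t : n.-tuple RT => f (c + d *: vec t))).
Proof.
move=> mS Soo SO; apply: measurable_bounded_integrable => //.
  exact: measurable_lip_affine.
exists (`|f x| + Lf * (d + rho)); split; first exact: num_real.
move=> z zM t St; apply: le_trans (ltW zM).
have Ox : O x by rewrite /O/= subrr enorm0 addr_gt0.
rewrite -[f _](subrK (f x)); apply: le_trans (ler_normD _ _) _.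
rewrite addrC lerD2l; apply: le_trans (fL (SO t St) Ox) _.
by rewrite ler_wpM2l// ltW//; exact: SO.
Qed.

Lemma affine_ball_near (h xi : 'rV[R]_n) : enorm h < rho -> enorm xi <= 1 ->
  O (x + h + d *: xi).
Proof.
move=> hr xi1; rewrite /O/= [X in enorm X](_ : _ = h + d *: xi); last first.
  by apply/rowP => i; rewrite !mxE; ring.
apply: le_lt_trans (enormD _ _) _; rewrite enormZ gtr0_norm//.
have : d * enorm xi <= d by rewrite ger_pMr.
lra.
Qed.

Lemma ball_integrable_lip (h : 'rV[R]_n) : enorm h < rho ->
  ball_integrable (fun xi => f (x + h + d *: xi)).
Proof.
move=> hr; apply: integrable_lip_affine; first exact: measurable_ballT.
  exact: lebesgue_ballT_lty.
by move=> t; rewrite /ballT/cball/= subr0 => t1; exact: affine_ball_near.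
Qed.

Let incrE h : enorm h < rho -> F (x + h) - F x =
  ball_mean (fun xi => f (x + h + d *: xi) - f (x + 0 + d *: xi)).
Proof.
move=> hr; rewrite ball_meanB ?addr0//; first exact: ball_integrable_lip.
by have := @ball_integrable_lip 0; rewrite enorm0 addr0; exact.
Qed.

Lemma ball_mean_incr_ge h c : enorm h < rho ->
  (forall xi, enorm xi <= 1 -> c <= f (x + h + d *: xi) - f (x + d *: xi)) ->
  c <= F (x + h) - F x.
Proof.
move=> hr hc; have z0 : enorm (0 : 'rV[R]_n) < rho by rewrite enorm0.
have ih := ball_integrable_lip hr; have i0 := ball_integrable_lip z0.
rewrite incrE// -[c](ball_mean_cst n).
apply: le_ball_mean; [exact: ball_integrable_cst|exact: ball_integrableB|].
by move=> xi xi1; rewrite addr0; exact: hc.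
Qed.

Lemma ball_mean_lip h : enorm h < rho -> `|F (x + h) - F x| <= Lf * enorm h.
Proof.
move=> hr; have z0 : enorm (0 : 'rV[R]_n) < rho by rewrite enorm0.
have ih := ball_integrable_lip hr; have i0 := ball_integrable_lip z0.
have bd xi : enorm xi <= 1 ->
    `|f (x + h + d *: xi) - f (x + 0 + d *: xi)| <= Lf * enorm h.
  move=> xi1; apply: le_trans (fL _ _) _; try exact: affine_ball_near.
  by rewrite le_eqVlt; apply/orP; left; apply/eqP; congr (_ * enorm _);
    apply/rowP => i; rewrite !mxE; ring.
rewrite incrE// ler_norml; apply/andP; split.
  rewrite -[- _](ball_mean_cst n).
  apply: le_ball_mean; [exact: ball_integrable_cst|exact: ball_integrableB|].
  by move=> xi /bd; rewrite ler_norml => /andP[].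
rewrite -[Lf * _](ball_mean_cst n).
apply: le_ball_mean; [exact: ball_integrableB|exact: ball_integrable_cst|].
by move=> xi /bd; rewrite ler_norml => /andP[].
Qed.

(** Let k be the increment of f by w, read in the variable of the unit ball. The second difference
    of [F] compares the integrals of k over the unit balls centred at h / d and at 0. There |k| <=
    Lf |w|, and each crescent has relative measure at most n |h| / d. The condition |h| < d keeps
    the centres at distance less than 1. *)
Lemma ball_mean_second_diff h w : enorm h + enorm w < rho -> enorm h < d ->
  `|(F (x + (h + w)) - F x) - (F (x + h) - F x) - (F (x + w) - F x)|
  <= 2 * n%:R * Lf / d * enorm h * enorm w.
Proof.
move=> hw hd; have h0 := enorm_ge0 h; have w0 := enorm_ge0 w.
have hr : enorm h < rho by lra.
have wr : enorm w < rho by lra.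
have hwr : enorm (h + w) < rho by exact: le_lt_trans (enormD _ _) hw.
have z0 : enorm (0 : 'rV[R]_n) < rho by rewrite enorm0.
pose k (u : 'rV[R]_n) := f (x + w + d *: u) - f (x + d *: u).
pose a := d^-1 *: h.
have dn0 : d != 0 by rewrite gt_eqF.
have aE : enorm a = enorm h / d by rewrite enormZ gtr0_norm ?invr_gt0// mulrC.
have ik0 : ball_integrable k.
  apply: ball_integrableB; first exact: ball_integrable_lip.
  by have := ball_integrable_lip z0; rewrite addr0.
have ika : ball_integrable (fun xi => k (xi + a)).
  have -> : (fun xi => k (xi + a)) =
      fun xi => f (x + (h + w) + d *: xi) - f (x + h + d *: xi).
    apply/funext => xi; rewrite /k; congr (f _ - f _);
      by apply/rowP => i; rewrite !mxE; field.
  by apply: ball_integrableB; exact: ball_integrable_lip.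
have diffE : (F (x + (h + w)) - F x) - (F (x + h) - F x) - (F (x + w) - F x)
    = ball_mean (fun xi => k (xi + a)) - ball_mean k.
  have -> : ball_mean k = F (x + w) - F x.
    by rewrite incrE//; congr ball_mean; apply/funext => xi; rewrite addr0.
  have -> : ball_mean (fun xi => k (xi + a)) = F (x + (h + w)) - F (x + h).
    rewrite -ball_meanB; [|exact: ball_integrable_lip|exact: ball_integrable_lip].
    congr ball_mean; apply/funext => xi; rewrite /k; congr (f _ - f _);
      by apply/rowP => i; rewrite !mxE; field.
  by ring.
(* A point u of the shifted ball only satisfies d |u| <= d + |h|; the assumption |h| + |w| < rho
   pays for this excess. *)
have kO t : (ballT a 1 `|` ballT 0 1) t ->
    O (x + w + d *: vec t) /\ O (x + d *: vec t).
  have aux u v : enorm (d *: u) <= d + enorm h -> enorm v + enorm h < rho ->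
      O (x + v + d *: u).
    move=> du vh; rewrite /O/= [X in enorm X](_ : _ = v + d *: u); last first.
      by apply/rowP => i; rewrite !mxE; ring.
    by apply: le_lt_trans (enormD _ _) _; lra.
  move=> h1; have : enorm (d *: vec t) <= d + enorm h.
    rewrite enormZ gtr0_norm//; case: h1; rewrite /ballT/cball/=.
      move=> ta; have := enormD (vec t - a) a; rewrite subrK aE => ta'.
      have : enorm (vec t) <= 1 + enorm h / d by lra.
      by rewrite -(ler_pM2l d0) mulrDr mulr1 mulrCA divff// mulr1.
    by rewrite subr0 => t1; have : d * enorm (vec t) <= d; [rewrite ger_pMr|lra].
  move=> dt; split; first by apply: aux => //; lra.
  by rewrite -(addr0 x); apply: aux => //; rewrite enorm0; lra.
have mk : measurable_fun (ballT a 1 `|` ballT 0 1) (k \o @vec R n).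
  have mU : measurable (ballT a 1 `|` ballT 0 1).
    by apply: measurableU; exact: measurable_ballT.
  apply: measurable_funB; apply: measurable_lip_affine => // t /kO[]//.
have kM t : (ballT a 1 `|` ballT 0 1) t -> `|k (vec t)| <= Lf * enorm w.
  move=> /kO[nw n0]; apply: le_trans (fL nw n0) _.
  by rewrite le_eqVlt; apply/orP; left; apply/eqP; congr (_ * enorm _);
    apply/rowP => i; rewrite !mxE; ring.
rewrite diffE !ball_meanE -mulrBl normrM normfV (gtr0_norm (ball_vol_gt0 n)).
rewrite ler_pdivrMr ?ball_vol_gt0// Rintegral_translate//; last first.
  by apply: measurable_funS mk => //; apply: measurableU; exact: measurable_ballT.
have a1 : enorm (a - 0) < 1 by rewrite subr0 aE ltr_pdivrMr// mul1r.
apply: le_trans (Rintegral_ballT_diff (mulr_ge0 Lf0 w0) a1 kM mk) _.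
by rewrite subr0 aE le_eqVlt; apply/orP; left; apply/eqP; field.
Qed.

Lemma ball_mean_frechet : exists p K, exists2 r', 0 < r' &
  forall h, enorm h < r' -> `|F (x + h) - F x - dot p h| <= K * enorm h ^+ 2.
Proof.
apply: (@approx_additive R n (fun h => F (x + h) - F x) (Num.min rho d)
  (2 * n%:R * Lf / d) Lf) => //.
- by rewrite divr_ge0 ?mulr_ge0// ltW.
- by rewrite lt_min rho0.
- move=> h w; rewrite lt_min => /andP[hw hd]; apply: ball_mean_second_diff => //.
  by have := enorm_ge0 w; lra.
- by move=> h; rewrite lt_min => /andP[hr _]; exact: ball_mean_lip.
Qed.

End LipschitzMean.

End BallMean.

(** * Jacobians of piecewise smooth maps *)

Section KernelAvoidance.
Context {R : realType}.

(** The common radius is the minimum of finitely many, capped by 1 so that it exists for empty [I].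
    A general [f] lets the lemma serve both for points near u and for small displacements. *)
Lemma fin_radius (I : finType) T (f : T -> R) (Q : I -> T -> Prop) :
  (forall i, exists2 e, 0 < e & forall s, f s < e -> Q i s) ->
  exists2 e, 0 < e & forall s, f s < e -> forall i, Q i s.
Proof.
move=> h; pose e i := s2val (cid2 (h i)).
have e0 i : 0 < e i := s2valP (cid2 (h i)).
have eP i s : f s < e i -> Q i s := s2valP' (cid2 (h i)) s.
exists (\big[Num.min/1]_i e i); first by elim/big_ind : _ => // a b; rewrite lt_min => -> ->.
move=> s fs i; apply: eP; apply: lt_le_trans fs _; exact: bigmin_le.
Qed.

(** The points 0, 1, 2, ... up to [size p] of them are one more than the degree allows as roots. *)
Lemma poly_non_root (p : {poly R}) : p != 0 -> exists t, p.[t] != 0.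
Proof.
move=> p0; apply: contrapT => h.
have hp t : root p t by apply: contrapT => /negP pt; apply: h; exists t.
pose s := [seq k%:R : R | k <- iota 0 (size p)].
have us : uniq s by rewrite map_inj_uniq ?iota_uniq// => i j /eqP; rewrite eqr_nat => /eqP.
have : all (root p) s by apply/allP => t _.
by move/(max_poly_roots p0)/(_ us); rewrite size_map size_iota ltnn.
Qed.

(* The witness lies on the moment curve (1, t, t^2, ...), which meets each kernel
   in finitely many points only. *)
Lemma avoid_kernels n m (I : finType) (Q : pred I) (B : I -> 'M[R]_(n, m)) :
  (forall i, Q i -> B i != 0) -> exists v : 'rV[R]_n, forall i, Q i -> v *m B i != 0.
Proof.
move=> B0; pose v t : 'rV[R]_n := \row_k t ^+ k.
have hp i : exists p : {poly R},
    p != 0 /\ (Q i -> forall t, p.[t] != 0 -> v t *m B i != 0).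
  have [Qi|_] := boolP (Q i); last by exists 1; split; first exact: oner_neq0.
  have /matrix0Pn[k0 [j Bkj]] := B0 i Qi.
  (* Entry j of [v t *m B i] as a polynomial in t; its coefficient of index k0 is the nonzero entry
     just found. *)
  pose p : {poly R} := \sum_(k < n) (B i k j)%:P * 'X^k.
  exists p; split=> [|_ t].
    apply: contraNneq Bkj => p0; have := congr1 (fun q : {poly R} => q`_k0) p0.
    rewrite coef0 coef_sum (bigD1 k0)//= coefCM coefXn eqxx mulr1 big1 ?addr0.
      by move=> ->.
    move=> k kk0; rewrite coefCM coefXn (_ : (k0 == k :> nat) = false) ?mulr0//.
    by rewrite eq_sym; apply/negbTE.
  apply: contraNneq => vB0; have := congr1 (fun M : 'rV[R]_m => M 0 j) vB0.
  rewrite !mxE => <-; rewrite horner_sum; apply/eqP/eq_bigr => k _.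
  by rewrite !hornerE mxE mulrC.
pose p i := projT1 (cid (hp i)).
(* A product of nonzero polynomials is nonzero, so a single t serves all indices at once. *)
have [t] : exists t, (\prod_i p i).[t] != 0.
  apply: poly_non_root; apply/prodf_neq0 => i _.
  by have [] := projT2 (cid (hp i)).
rewrite horner_prod => /prodf_neq0 pt; exists (v t) => i Qi.
by have [_ /(_ Qi t)] := projT2 (cid (hp i)); apply; exact: pt.
Qed.

End KernelAvoidance.

(** * Local structure of a piecewise smooth map *)

Section Pieces.
Context {R : realType} (n m N : nat).
Context (U : set 'rV[R]_n) (P : 'I_N -> set 'rV[R]_n).
Context (y : 'rV[R]_n -> 'rV[R]_m) (yi : 'I_N -> 'rV[R]_n -> 'rV[R]_m).
Hypotheses (oU : open U) (yP : piecewise_C11 U P y yi).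

Lemma piece_sub i : P i `<=` U.
Proof. by case: yP => -[-> _ _ _] _ _ _ u Pu; exists i. Qed.

Lemma piece_cover u : U u -> exists i, P i u.
Proof. by case: yP => -[-> _ _ _] _ _ _ [i _ Pi]; exists i. Qed.

Lemma piece_closed i u : closure (P i) u -> U u -> P i u.
Proof. by case: yP => -[_ _ cP _] _ _ _ Pu Uu; exact: cP. Qed.

Lemma piece_closure_interior i u : P i u -> closure (interior (P i)) u.
Proof. by case: yP => -[_ _ _ hP] _ _ _; exact: hP. Qed.

Lemma piece_eq i u : P i u -> y u = yi i u.
Proof. by case: yP => _ _ h _; exact: h. Qed.

Lemma piece_differentiable i u : P i u -> differentiable (yi i) u.
Proof.
case: yP => _ _ _ /(_ i) [W [K [_ PW dW _]]] Pu.
by apply/dW/PW; exact: subset_closure.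
Qed.

Lemma piece_Jac_continuous i u : P i u -> forall e, 0 < e ->
  exists2 r, 0 < r & forall s, enorm (s - u) < r ->
    opnorm (Jac (yi i) s - Jac (yi i) u) < e.
Proof.
case: yP => _ _ _ /(_ i) [W [K [oW PW _ lipK]]] Pu e e0.
have Wu : W u by apply: PW; exact: subset_closure.
have /nbhs_enormP[r r0 rW] : nbhs u W by exact: open_nbhs_nbhs.
have K0 : 0 < `|K| + 1 by rewrite ltr_wpDl.
exists (Num.min r (e / (`|K| + 1))); first by rewrite lt_min r0 divr_gt0.
move=> s; rewrite lt_min => /andP[sr]; rewrite ltr_pdivlMr// => se.
apply: le_lt_trans (lipK _ _ (rW _ sr) Wu) _; apply: le_lt_trans se.
by rewrite mulrC ler_wpM2l ?enorm_ge0// (le_trans (ler_norm K))// lerDl.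
Qed.

(** A piece missing u has a closure missing u, by closedness in U, hence avoids a ball around u;
    finiteness gives a common radius. *)
Lemma pieces_near u : U u -> exists2 e, 0 < e &
  forall s, enorm (s - u) < e -> U s /\ forall i, P i s -> P i u.
Proof.
move=> Uu; have [e1 e10 h1] : exists2 e, 0 < e &
    forall s, enorm (s - u) < e -> forall i, P i s -> P i u.
  apply: (@fin_radius _ _ _ (fun s => enorm (s - u)) (fun i s => P i s -> P i u)).
  move=> i; have [Pu|nPu] := pselect (P i u); first by exists 1.
  have : nbhs u (~` closure (P i)).
    apply: open_nbhs_nbhs; split; first by rewrite openC; exact: closed_closure.
    by move=> cPu; apply: nPu; exact: piece_closed.
  move=> /nbhs_enormP[e e0 eP]; exists e => // s /eP nP Ps.
  by case: nP; exact: subset_closure.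
have /nbhs_enormP[e2 e20 h2] : nbhs u U by exact: open_nbhs_nbhs.
exists (Num.min e1 e2); first by rewrite lt_min e10.
by move=> s; rewrite lt_min => /andP[se1 se2]; split; [exact: h2|exact: h1].
Qed.

(* y - yi i vanishes on P i, which may be a cusp at u; still, every ray from u
   meets some active piece at points arbitrarily close to u. *)
Lemma Jac_selection u : U u -> differentiable y u ->
  exists2 i, P i u & Jac y u = Jac (yi i) u.
Proof.
move=> Uu dy; apply: contrapT => hJ.
(* If no active piece has the Jacobian of y, every active [B i] is nonzero and one direction v
   avoids all their kernels: along v, y departs to first order from every active piece. *)
pose B i := jacobian y u - jacobian (yi i) u.
have [v vB] : exists v : 'rV[R]_n, forall i, `[< P i u >] -> v *m B i != 0.
  apply: (avoid_kernels (Q := fun i => `[< P i u >])) => i /asboolP Pu; apply/eqP.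
  rewrite /B => /subr0_eq Bi.
  by apply: hJ; exists i; [exact: Pu|rewrite /Jac Bi].
have [e0 e00 near_u] := pieces_near Uu.
have fy := (frechetP y u (jacobian y u)).2 (conj dy erefl).
have [e1 e10 h1] : exists2 e, 0 < e & forall h, enorm h < e -> forall i,
    (exists2 t, t != 0 & h = t *: v) -> P i u -> ~ P i (u + h).
  apply: (@fin_radius _ _ _ (@enorm R n) (fun i h =>
    (exists2 t, t != 0 & h = t *: v) -> P i u -> ~ P i (u + h))) => i.
  have [Pu|nPu] := pselect (P i u); last by exists 1.
  have vBi : 0 < enorm (v *m B i).
    rewrite lt_def enorm_ge0 andbT; apply: contra (vB i (asboolT Pu)).
    by move=> /eqP/enorm_eq0/eqP.
  (* If u + t v were in [P i], y and [yi i] would have equal increments, and |t| |v B_i| would be at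
     most the two remainders, 2 eps |t| |v|. This eps excludes it; the + 1 keeps the denominator
     positive. *)
  pose eps := enorm (v *m B i) / (2 * (enorm v + 1)).
  have v1 : 0 < enorm v + 1 by rewrite ltr_wpDl// enorm_ge0.
  have eps0 : 0 < eps by rewrite divr_gt0// mulr_gt0.
  have fyi := (frechetP (yi i) u _).2 (conj (piece_differentiable Pu) erefl).
  have [d1 d10 hd1] := fy _ eps0; have [d2 d20 hd2] := fyi _ eps0.
  exists (Num.min d1 d2); first by rewrite lt_min d10.
  move=> h; rewrite lt_min => /andP[hh1 hh2] [t t0 ht] _ Puh.
  have tp : 0 < `|t| by rewrite normr_gt0.
  have hv : enorm h = `|t| * enorm v by rewrite ht enormZ.
  have ha := hd1 h hh1; have hb := hd2 h hh2.
  rewrite -(piece_eq Puh) -(piece_eq Pu) enormBC in hb.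
  rewrite enormBC in ha.
  have hB : `|t| * enorm (v *m B i) <= eps * enorm h + eps * enorm h.
    refine (le_trans _ (lerD ha hb)); rewrite [X in _ + X]enormBC.
    refine (le_trans _ (enormB_le _ _ _)).
    by rewrite -mulmxBr ht -scalemxAl enormZ.
  have epsE : 2 * eps * (enorm v + 1) = enorm (v *m B i).
    by rewrite /eps; field; rewrite gt_eqF.
  have : `|t| * enorm (v *m B i) <= `|t| * (2 * eps * enorm v).
    by refine (le_trans hB _); rewrite hv le_eqVlt; apply/orP; left; apply/eqP; ring.
  have eps2 : 0 < 2 * eps by rewrite mulr_gt0.
  by rewrite ler_pM2l// -epsE (ler_pM2l eps2) gerDl ler10.
pose d := Num.min e0 e1; have d0 : 0 < d by rewrite lt_min e00.
have v1 : 0 < enorm v + 1 by rewrite ltr_wpDl// enorm_ge0.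
pose t := d / 2 / (enorm v + 1).
have t0 : 0 < t by rewrite !divr_gt0.
have tv : enorm (t *: v) < d.
  have tE : t * (enorm v + 1) = d / 2 by rewrite divfK// gt_eqF.
  rewrite enormZ gtr0_norm//; apply: (@le_lt_trans _ _ (d / 2)).
    by rewrite -tE ler_pM2l// lerDl.
  by rewrite ltr_pdivrMr// ltr_pMr// ltr1n.
move: tv; rewrite lt_min => /andP[tv0 tv1].
have [Ut Pt] : U (u + t *: v) /\ forall i, P i (u + t *: v) -> P i u.
  by apply: near_u; rewrite addrAC subrr add0r.
(* Some piece covers u + t v; it contains u, which [h1] forbids. *)
have [i Pi] := piece_cover Ut.
by apply: (h1 _ tv1 i _ (Pt i Pi) Pi); exists t => //; rewrite gt_eqF.
Qed.

End Pieces.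

(** * Limiting Jacobians and the variation bound *)

Section Clarke.
Context {R : realType} (n m N : nat).
Context (U : set 'rV[R]_n) (P : 'I_N -> set 'rV[R]_n).
Context (y : 'rV[R]_n -> 'rV[R]_m) (yi : 'I_N -> 'rV[R]_n -> 'rV[R]_m).
Hypotheses (oU : open U) (yP : piecewise_C11 U P y yi).

Lemma closure_enorm_seq (A : set 'rV[R]_n) x : closure A x ->
  exists2 xs : nat -> 'rV[R]_n, forall k, A (xs k) & xs @ \oo --> x.
Proof.
move=> Ax; have near_pt k : exists s, A s /\ enorm (s - x) < k.+1%:R^-1.
  have [|s [As sx]] := Ax [set s | enorm (s - x) < k.+1%:R^-1].
    by apply/nbhs_enormP; exists k.+1%:R^-1; rewrite ?invr_gt0.
  by exists s.
pose xs k := projT1 (cid (near_pt k)).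
have xsP k : A (xs k) /\ enorm (xs k - x) < k.+1%:R^-1 := projT2 (cid (near_pt k)).
exists xs => [k|]; first by have [] := xsP k.
apply/cvg_enormP => e e0; have /ltr_add_invr[k hk] := e0; exists k => // j kj.
have [_ h] := xsP j; apply: lt_trans h _; apply: le_lt_trans (hk).
by rewrite add0r lef_pV2 ?posrE// ler_nat ltnS.
Qed.

Lemma piece_interior i u : interior (P i) u ->
  differentiable y u /\ Jac y u = Jac (yi i) u.
Proof.
move=> Pu; have Piu : P i u := interior_subset Pu.
have /nbhs_enormP[e0 e00 hP] := Pu.
have := (frechetP (yi i) u _).2 (conj (piece_differentiable yP Piu) erefl).
move=> fyi; have [|dy Jy] := (frechetP y u (jacobian (yi i) u)).1.
  move=> e /fyi[d d0 hd]; exists (Num.min d e0); first by rewrite lt_min d0.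
  move=> h; rewrite lt_min => /andP[hd' he0].
  have Puh : P i (u + h) by apply: hP; rewrite addrAC subrr add0r.
  by rewrite (piece_eq yP Puh) (piece_eq yP Piu); exact: hd.
by split; [exact: dy|rewrite /Jac Jy].
Qed.

Lemma piece_Jac_cvg i u (xs : nat -> 'rV[R]_n) : P i u -> xs @ \oo --> u ->
  (fun k => Jac (yi i) (xs k)) @ \oo --> Jac (yi i) u.
Proof.
move=> Pu /cvg_enormP xsu; apply/cvgrPdist_lt => e e0.
have [r r0 hr] := piece_Jac_continuous yP Pu e0.
apply: filterS (xsu _ r0) => k /hr; rewrite distrC.
by apply: le_lt_trans; exact: mxnorm_le_opnorm.
Qed.

Lemma not_both_near (V : normedModType R) (a b c : V) :
  `|a - b| < `|a - c| / 2 -> `|c - b| < `|a - c| / 2 -> False.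
Proof.
move=> h1 h2; have := ler_distD b a c.
by rewrite (distrC b) => /le_lt_trans/(_ (ltrD h1 h2)); rewrite -splitr ltxx.
Qed.

(** The generators whose convex hull is [clarke_jac D y x]. *)
Definition limiting_jac (D : set 'rV[R]_n) (x : 'rV[R]_n) : set 'M[R]_(m, n) :=
  [set V | exists xs : nat -> 'rV[R]_n,
    [/\ forall k, diff_pts D y (xs k), xs @ \oo --> x
      & (fun k => Jac y (xs k)) @ \oo --> V]].

(** If V differed from all the finitely many active [Jac (yi i) s], then far along the sequence
    [Jac y] would differ from every active [Jac (yi i)], against [Jac_selection]. Treating all
    indices at once avoids extracting a subsequence of constant index. *)
Lemma limiting_jac_piece D s V : U s -> limiting_jac D s V ->
  exists2 i, P i s & V = Jac (yi i) s.
Proof.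
move=> Us [xs [dxs xss JV]]; apply: contrapT => hV.
have [e e0 near_s] := pieces_near oU yP Us.
have ev1 : \forall k \near \oo, enorm (xs k - s) < e.
  by move/cvg_enormP : xss; exact.
have ev2 : \forall k \near \oo, forall i, P i s ->
    Jac y (xs k) <> Jac (yi i) (xs k).
  apply: (@filter_forall _ _ (fun i k =>
    P i s -> Jac y (xs k) <> Jac (yi i) (xs k)) \oo) => i.
  have [Ps|nPs] := pselect (P i s); last first.
    by exists 0%N; [exact: I|move=> k _ /nPs[]].
  have VJ : 0 < `|V - Jac (yi i) s|.
    rewrite normr_gt0 subr_eq0; apply/eqP => VJ.
    by apply: hV; exists i; [exact: Ps|exact: VJ].
  have VJ2 : 0 < `|V - Jac (yi i) s| / 2 by rewrite divr_gt0.
  move/cvgrPdist_lt : JV => /(_ _ VJ2) J1.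
  have /cvgrPdist_lt/(_ _ VJ2) J2 := piece_Jac_cvg Ps xss.
  apply: filterS2 J1 J2 => k h1 h2 _ JE.
  by rewrite JE in h1; exact: (not_both_near h1 h2).
have [k [h1 h2]] : exists k, enorm (xs k - s) < e /\
    forall i, P i s -> Jac y (xs k) <> Jac (yi i) (xs k).
  by have [k [? ?]] := filter_ex (filterI ev1 ev2); exists k.
have [Uk Pk] := near_s _ h1; have [_ dk] := dxs k.
have [i Pi Ji] := Jac_selection oU yP Uk dk.
exact: (h2 i (Pk i Pi) Ji).
Qed.

Lemma piece_limiting_jac D i x : U `<=` D -> P i x ->
  limiting_jac D x (Jac (yi i) x).
Proof.
move=> UD Px.
have [xs xsP xsx] := closure_enorm_seq (piece_closure_interior yP Px).
exists xs; split=> // [k|].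
  split; last by have [] := piece_interior (xsP k).
  by apply: UD; apply: (piece_sub yP (i := i)); exact: interior_subset (xsP k).
rewrite (_ : (fun k => _) = fun k => Jac (yi i) (xs k)).
  exact: piece_Jac_cvg.
by apply/funext => k; have [_] := piece_interior (xsP k).
Qed.

Variables (D : set 'rV[R]_n) (x : 'rV[R]_n) (delta : R) (L : 'I_N -> R).
Hypotheses (UD : U `<=` D) (delta0 : 0 < delta) (Bx : cball x delta `<=` U).
Hypothesis reg : regular P delta x.
Hypothesis JL : forall i, active P x i -> exists W, [/\ open W,
  closure (P i) `<=` W & lipschitz_in (@opnorm R m n) (L i) W (Jac (yi i))].

Lemma cball_center : cball x delta x.
Proof. by rewrite /cball/= subrr enorm0 ltW. Qed.

Lemma active_piece i : active P x i -> P i x.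
Proof. by move=> Px; apply: (piece_closed yP Px); exact/Bx/cball_center. Qed.

Lemma max_active_ge0 : 0 <= max_active P L x.
Proof. exact: bigmax_ge_id. Qed.

Lemma piece_Jac_lip i s : P i s -> active P x i ->
  opnorm (Jac (yi i) s - Jac (yi i) x) <= max_active P L x * enorm (s - x).
Proof.
move=> Ps Px; have [W [_ PW lipW]] := JL Px.
apply: le_trans (lipW _ _ _ _) _; try by apply: PW => //; exact: subset_closure.
rewrite ler_wpM2r ?enorm_ge0//.
by apply: le_bigmax_cond; exact/mem_set.
Qed.

Lemma clarke_variation_le :
  (clarke_variation D y x delta <= (max_active P L x * delta)%:E)%E.
Proof.
apply: ge_ereal_sup => _ [s /= sx <-]; apply: ge_ereal_sup => _ [V /= VJ <-].
have [k [c [p [c0 c1 pJ ->]]]] := VJ.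
have Us := Bx sx.
have hi j : exists i, P i s /\ p j = Jac (yi i) s.
  by have [i Pi pi] := limiting_jac_piece Us (pJ j); exists i.
pose i j := projT1 (cid (hi j)).
have iP j : P (i j) s /\ p j = Jac (yi (i j)) s := projT2 (cid (hi j)).
have ai j : active P x (i j).
  by apply: reg; exists s; split => //; have [] := iP j.
apply: (@le_trans _ _ (opnorm (\sum_j c j *: p j -
    \sum_j c j *: Jac (yi (i j)) x))%:E).
  apply: ereal_inf_lbound; exists (\sum_j c j *: Jac (yi (i j)) x) => //.
  exists k, c, (fun j => Jac (yi (i j)) x); split => // j.
  by apply: piece_limiting_jac => //; exact: active_piece.
rewrite lee_fin -sumrB; under eq_bigr do rewrite -scalerBr.
apply: opnorm_conv => // j; have [Pj ->] := iP j.
apply: le_trans (piece_Jac_lip Pj (ai j)) _.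
by rewrite ler_wpM2l// max_active_ge0.
Qed.

End Clarke.

(** * Separation from polytopes and limiting gradients *)

Section Separation.
Context {R : realType}.

Lemma dot_quad n (q u : 'rV[R]_n) t : dot (q + t *: u) (q + t *: u) =
  dot q q + 2 * (t * dot q u) + t * (t * dot u u).
Proof. by rewrite !(dotDl, dotDr, dotZl, dotZr) (dotC u q); ring. Qed.

(* A near-minimizer w of the distance from z to the polytope would come closer to
   z, by an amount independent of w, when moved towards the vertex v j that the
   hypothesis provides for q = w - z. *)
Lemma edist_conv_le n k (z : 'rV[R]_n) (S : set 'rV[R]_n) (v : 'I_k -> 'rV[R]_n) r :
  0 <= r -> (forall j, S (v j)) ->
  (forall q, exists j, dot q (v j) <= dot q z + r * enorm q) ->
  (edist (@enorm R n) z (conv_hull S) <= r%:E)%E.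
Proof.
move=> r0 Sv sep.
pose K : set 'rV[R]_n := [set w | exists c : 'I_k -> R,
  [/\ forall i, 0 <= c i, \sum_i c i = 1 & w = \sum_i c i *: v i]].
have KS : K `<=` conv_hull S.
  by move=> w [c [c0 c1 ->]]; exists k, c, v; split.
have Kv j : K (v j).
  exists (fun i => (i == j)%:R); split => [i||]; first exact: ler0n.
    by rewrite (bigD1 j)//= eqxx big1 ?addr0// => i /negPf ->.
  by rewrite (bigD1 j)//= eqxx scale1r big1 ?addr0// => i /negPf ->; rewrite scale0r.
have Kseg w j t : 0 <= t -> t <= 1 -> K w -> K (w + t *: (v j - w)).
  move=> t0 t1 [c [c0 c1 wE]]; exists (fun i => (1 - t) * c i + t * (i == j)%:R).
  split => [i||].
  - by rewrite addr_ge0// mulr_ge0// subr_ge0.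
  - have dj : \sum_i ((i == j)%:R : R) = 1.
      by rewrite (bigD1 j)//= eqxx big1 ?addr0// => i /negPf ->.
    by rewrite big_split/= -!mulr_sumr c1 dj; ring.
  - under eq_bigr do rewrite scalerDl -!scalerA.
    rewrite big_split/= -!scaler_sumr -wE [X in _ = _ + _ *: X](_ : _ = v j).
      by apply/rowP => i; rewrite !mxE; ring.
    rewrite (bigD1 j)//= eqxx scale1r big1 ?addr0// => i /negPf ->.
    by rewrite scale0r.
(* This only produces an index, so that the polytope is nonempty. *)
have [j0 _] := sep 0.
apply/lee_addgt0Pr => e e0.
suff [w [Kw wz]] : exists w, K w /\ enorm (z - w) <= r + e.
  apply: (@le_trans _ _ (enorm (z - w))%:E); last by rewrite -EFinD lee_fin.
  by apply: ereal_inf_lbound; exists w => //; exact: KS.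
apply: contrapT => far.
have {}far w : K w -> r + e < enorm (w - z).
  by move=> Kw; rewrite ltNge; apply/negP => h; apply: far; exists w; rewrite enormBC.
pose A := [set dot (w - z) (w - z) | w in K].
have A0 : A !=set0 by exists (dot (v j0 - z) (v j0 - z)), (v j0).
have lA : has_lbound A by exists 0 => _ [w _ <-]; exact: dotvv_ge0.
have a0 : 0 <= inf A by apply: lb_le_inf => // _ [w _ <-]; exact: dotvv_ge0.
set a := inf A in a0.
(* Will bound every |v j - w|: a near-minimizer has |w - z| <= a + 1, because its squared distance
   is below a + 1 <= (a + 1)^2. *)
pose M := a + 2 + \sum_j enorm (v j - z).
have M1 : 1 <= M.
  have : 0 <= \sum_j enorm (v j - z) by apply: sumr_ge0 => j _; exact: enorm_ge0.
  by rewrite /M; move: (\sum_j _) => ?; lra.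
(* With q = w - z and |q| > r + e, the pairing of q with v j - w is at most r |q| - |q|^2, hence at
   most - eta. *)
pose eta := (r + e) * e.
have eta0 : 0 < eta by rewrite mulr_gt0// ltr_wpDl.
(* Ensures t M^2 <= eta: the quadratic term then costs at most t eta against a gain of 2 t eta, a
   net decrease of t eta whatever w is. *)
pose t := eta / (M ^+ 2 + eta).
have Me : 0 < M ^+ 2 + eta by rewrite ltr_wpDl// sqr_ge0.
have t0 : 0 < t by rewrite divr_gt0.
have t1 : t <= 1 by rewrite ler_pdivrMr// mul1r lerDr sqr_ge0.
have tM : t * M ^+ 2 <= eta.
  have : t * (M ^+ 2 + eta) = eta by rewrite divfK// gt_eqF.
  have : 0 <= t * eta by rewrite mulr_ge0// ltW.
  by move: (t) (eta) (M ^+ 2) => ? ? ?; lra.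
(* The 1 bounds w; the t eta lets the net decrease fall below the infimum a. *)
have tau0 : 0 < Num.min 1 (t * eta) by rewrite lt_min ltr01 mulr_gt0.
have [_ [w Kw <-]] := inf_adherent tau0 (conj A0 lA).
rewrite -/a => wa; have {wa} [wa1 wa2] : dot (w - z) (w - z) < a + 1 /\
    dot (w - z) (w - z) < a + t * eta.
  split; apply: lt_le_trans wa _; rewrite lerD2l; first by rewrite ge_min lexx.
  by rewrite ge_min lexx orbT.
have [j hj] := sep (w - z).
have fw := far w Kw.
have wzM : enorm (w - z) <= a + 1.
  apply: enorm_le; first by lra.
  by apply: le_trans (ltW wa1) _; move: (a) a0 => b b0; nra.
have vM : enorm (v j - w) <= M.
  apply: le_trans (enormB_le _ z _) _; rewrite (enormBC z) /M.
  have : enorm (v j - z) <= \sum_j enorm (v j - z).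
    by rewrite (bigD1 j)//= lerDl sumr_ge0// => i _; exact: enorm_ge0.
  by move: (\sum_j _) => ?; lra.
have desc : dot (w - z) (v j - w) <= - eta.
  have -> : dot (w - z) (v j - w) = dot (w - z) (v j) - dot (w - z) z
      - enorm (w - z) ^+ 2 by rewrite enorm_sqr !dotBr; ring.
  apply: (@le_trans _ _ (r * enorm (w - z) - enorm (w - z) ^+ 2)); first by lra.
  rewrite /eta; move: (enorm _) fw => D fw; nra.
have : a <= dot (w + t *: (v j - w) - z) (w + t *: (v j - w) - z).
  apply: ge_inf => //; exists (w + t *: (v j - w)) => //.
  by apply: Kseg => //; exact: ltW.
have -> : w + t *: (v j - w) - z = (w - z) + t *: (v j - w).
  by apply/rowP => i; rewrite !mxE; ring.
rewrite dot_quad.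
have vv : dot (v j - w) (v j - w) <= M ^+ 2.
  by rewrite -enorm_sqr lerXn2r ?nnegrE ?enorm_ge0//; lra.
have h1 : t * (t * dot (v j - w) (v j - w)) <= t * eta.
  rewrite ler_pM2l//; apply: le_trans tM; by rewrite ler_pM2l.
have h2 : t * dot (w - z) (v j - w) <= t * - eta by rewrite ler_pM2l.
move: wa2 h1 h2; move: (dot (w - z) (w - z)) (dot (w - z) (v j - w)) (dot (v j - w) (v j - w)) => ? ? ?.
by move: (a) (t) (eta) => ? ? ?; lra.
Qed.

End Separation.

(** * Chain rule along the graph of the response *)

Section Gradients.
Context {R : realType} (n m : nat).
Implicit Types (phi : 'rV[R]_n * 'rV[R]_m -> R) (y : 'rV[R]_n -> 'rV[R]_m).

Lemma diff_graph phi y (u v : 'rV[R]_n) : differentiable phi (u, y u) ->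
  differentiable y u ->
  differentiable (fun s => phi (s, y s)) u /\
  'd (fun s => phi (s, y s)) u v = 'd phi (u, y u) (v, 'd y u v) :> R.
Proof.
move=> dphi dy; have dg : differentiable (fun s => (s, y s)) u.
  by apply: differentiable_pair.
split; first exact: (differentiable_comp dg dphi).
rewrite -[fun s => phi (s, y s)]/(phi \o (fun s => (s, y s))) diff_comp//=.
rewrite diff_pair//= (_ : 'd (fun s : 'rV[R]_n => s) u = id :> ('rV[R]_n -> 'rV[R]_n))//.
exact: (@diff_val _ _ _ _ _ _ _ (is_diff_id u)).
Qed.

Lemma dot_gradE (f : 'rV[R]_n -> R) u j : grad f u 0 j = 'd f u (delta_mx 0 j).
Proof. by rewrite mxE. Qed.

(** Expresses the partial gradient through the total differential, the object whose continuity [C1]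
    provides. *)
Lemma grad1E phi p j : differentiable phi p ->
  grad1 phi p 0 j = 'd phi p (delta_mx 0 j, 0).
Proof.
case: p => u v dphi; rewrite /grad1/grad mxE /=.
have := @diff_graph phi (fun=> v) u (delta_mx 0 j) dphi (differentiable_cst _ _).
by move=> [_ ->]; rewrite diff_cst.
Qed.

Lemma grad2E phi p j : differentiable phi p ->
  grad2 phi p 0 j = 'd phi p (0, delta_mx 0 j).
Proof.
case: p => u v dphi; rewrite /grad2/grad mxE /=.
have dg : differentiable (fun s : 'rV[R]_m => (u, s)) v.
  by apply: differentiable_pair.
rewrite -[fun s => phi (u, s)]/(phi \o (fun s => (u, s))) diff_comp//=.
rewrite diff_pair//= diff_cst.
rewrite (_ : 'd (fun s : 'rV[R]_m => s) v = id :> ('rV[R]_m -> 'rV[R]_m))//.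
exact: (@diff_val _ _ _ _ _ _ _ (is_diff_id v)).
Qed.

Lemma linear_pair (f : {linear ('rV[R]_n * 'rV[R]_m)%type -> R}) (v : 'rV[R]_n) (w : 'rV[R]_m) :
  f (v, w) = f (v, 0) + \sum_l w 0 l * f (0, delta_mx 0 l).
Proof.
have -> : (v, w) = (v, 0) + (0, w).
  by apply: injective_projections; rewrite /= ?addr0 ?add0r.
rewrite linearD; congr (_ + _); rewrite {1}(row_sum_delta w).
have -> : (0, \sum_l w 0 l *: delta_mx 0 l) =
    \sum_l w 0 l *: ((0, delta_mx 0 l) : 'rV[R]_n * 'rV[R]_m).
  rewrite (big_morph (fun b : 'rV[R]_m => ((0, b) : 'rV[R]_n * 'rV[R]_m))
    (id1 := 0) (op1 := +%R)) => [|a b|//].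
    by apply: eq_bigr => l _; apply: injective_projections; rewrite //= scaler0.
  by apply: injective_projections; rewrite //= addr0.
by rewrite linear_sum; apply: eq_bigr => l _; rewrite linearZ.
Qed.

(** Same shape as [bizol_hypergrad], with the Jacobian of y in place of that of its smoothing: this
    is why the polytope vertices are limiting gradients. *)
Lemma grad_graph phi y (u : 'rV[R]_n) : differentiable phi (u, y u) ->
  differentiable y u -> grad (fun s => phi (s, y s)) u =
  grad1 phi (u, y u) + grad2 phi (u, y u) *m Jac y u.
Proof.
move=> dphi dy; apply/rowP => j.
have [_ dE] := diff_graph (delta_mx 0 j) dphi dy.
rewrite dot_gradE dE linear_pair mxE grad1E//; congr (_ + _).
rewrite mxE; apply: eq_bigr => l _; rewrite grad2E// mulrC; congr (_ * _).
by rewrite -mul_rV_lin1 -rowE !mxE.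
Qed.

Lemma cvg_row k T (F : set_system T) {FF : Filter F} (f : T -> 'rV[R]_k) (v : 'rV[R]_k) :
  (forall j, (fun t => f t 0 j) @ F --> v 0 j) -> f @ F --> v.
Proof.
move=> fv; apply/cvgrPdist_lt => e e0.
have e2 : 0 < e / 2 by rewrite divr_gt0.
have : \forall t \near F, forall j, `|v 0 j - f t 0 j| < e / 2.
  by apply: filter_forall => j; have /cvgrPdist_lt := fv j; exact.
apply: filterS => t ht; apply: (@le_lt_trans _ _ (e / 2)).
  apply: mxnorm_le; first exact: ltW.
  by move=> i j; rewrite ord1 !mxE; exact: ltW.
by rewrite ltr_pdivrMr// ltr_pMr// ltr1n.
Qed.

Lemma cvg_coord k l T (F : set_system T) {FF : Filter F} (f : T -> 'M[R]_(k, l)) (v : 'M[R]_(k, l)) i j :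
  f @ F --> v -> (fun t => f t i j) @ F --> v i j.
Proof.
move=> /cvgrPdist_lt fv; apply/cvgrPdist_lt => e /fv; apply: filterS => t.
by apply: le_lt_trans; have := coord_le_mxnorm (v - f t) i j; rewrite !mxE.
Qed.

(** Continuity of the differential is available against each fixed vector, so convergence is checked
    coordinate by coordinate. *)
Lemma cvg_grad_graph phi (ps : nat -> 'rV[R]_n * 'rV[R]_m) p
    (As : nat -> 'M[R]_(m, n)) A :
  C1 phi -> ps @ \oo --> p -> As @ \oo --> A ->
  (fun k => grad1 phi (ps k) + grad2 phi (ps k) *m As k) @ \oo -->
  grad1 phi p + grad2 phi p *m A.
Proof.
move=> [dphi cphi] psp AsA.
have cv v : (fun k => 'd phi (ps k) v) @ \oo --> ('d phi p v : R).
  exact: (cvg_comp ps (fun q => 'd phi q v) psp (cphi v p)).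
have h1 j : (fun k => grad1 phi (ps k) 0 j) @ \oo --> grad1 phi p 0 j.
  rewrite (_ : (fun k => _) = fun k => 'd phi (ps k) (delta_mx 0 j, 0)); last first.
    by apply/funext => k; exact: grad1E (dphi _).
  by rewrite (grad1E j (dphi p)); exact: cv.
have h2 l : (fun k => grad2 phi (ps k) 0 l) @ \oo --> grad2 phi p 0 l.
  rewrite (_ : (fun k => _) = fun k => 'd phi (ps k) (0, delta_mx 0 l)); last first.
    by apply/funext => k; exact: grad2E (dphi _).
  by rewrite (grad2E l (dphi p)); exact: cv.
apply: cvg_row => j; rewrite (_ : (fun k => _) = fun k => grad1 phi (ps k) 0 j +
    \sum_l grad2 phi (ps k) 0 l * As k l j); last first.
  by apply/funext => k; rewrite mxE [X in _ + X]mxE.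
have -> : (grad1 phi p + grad2 phi p *m A) 0 j =
    grad1 phi p 0 j + \sum_l grad2 phi p 0 l * A l j.
  by rewrite mxE [X in _ + X]mxE.
have h3 : (fun k => \sum_l grad2 phi (ps k) 0 l * As k l j) @ \oo -->
    \sum_l grad2 phi p 0 l * A l j.
  apply: cvg_big => [|l _]; first exact: add_continuous.
  exact: (cvgM (h2 l) (cvg_coord (i := l) (j := j) AsA)).
exact: (cvgD (h1 j) h3).
Qed.

End Gradients.

Section LimitingGradients.
Context {R : realType} (n m N : nat).
Context (U : set 'rV[R]_n) (P : 'I_N -> set 'rV[R]_n).
Context (y : 'rV[R]_n -> 'rV[R]_m) (yi : 'I_N -> 'rV[R]_n -> 'rV[R]_m).
Hypotheses (oU : open U) (yP : piecewise_C11 U P y yi).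

Lemma piece_limiting_grad D phi i x : U `<=` D -> C1 phi -> P i x ->
  exists xs : nat -> 'rV[R]_n,
    [/\ forall k, diff_pts D (fun u => phi (u, y u)) (xs k), xs @ \oo --> x
      & (fun k => grad (fun u => phi (u, y u)) (xs k)) @ \oo -->
          grad1 phi (x, y x) + grad2 phi (x, y x) *m Jac (yi i) x].
Proof.
move=> UD phi1 Px; have [dphi _] := phi1.
have [xs xsP xsx] := closure_enorm_seq (piece_closure_interior yP Px).
have dy k : differentiable y (xs k) by have [] := piece_interior yP (xsP k).
exists xs; split=> // [k|].
  split; first by apply: UD; apply: (piece_sub yP (i := i)); exact: interior_subset (xsP k).
  by have [] := diff_graph 0 (dphi _) (dy k).
rewrite (_ : (fun k => _) = fun k => grad1 phi (xs k, y (xs k)) +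
    grad2 phi (xs k, y (xs k)) *m Jac (yi i) (xs k)); last first.
  apply/funext => k; have [_ JE] := piece_interior yP (xsP k).
  by rewrite -JE; exact: grad_graph (dphi _) (dy k).
(* Along the sequence and at x, y coincides with [yi i], whose differentiability gives the
   continuity. *)
have yx : (fun k => y (xs k)) @ \oo --> y x.
  rewrite (piece_eq yP Px) (_ : (fun k => y (xs k)) = (fun k => yi i (xs k))).
    apply: (cvg_comp xs (yi i) xsx).
    exact: differentiable_continuous (piece_differentiable yP Px).
  by apply/funext => k; rewrite (piece_eq yP (interior_subset (xsP k))).
have px : (fun k => (xs k, y (xs k))) @ \oo --> (x, y x).
  exact: cvg_pair xsx yx.
exact: (cvg_grad_graph phi1 px (piece_Jac_cvg yP Px xsx)).
Qed.

End LimitingGradients.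

(** * The smoothed response *)

Section LocallyIncreasing.
Context {R : realType}.

(** The hypothesis compares each t with its neighbours only; it does not assert monotonicity around
    t. At the supremum c of the t with psi 0 <= psi t, the comparison on the left shows psi 0 <= psi
    c, and the one on the right moves past c unless c = 1. *)
Lemma locally_nondecreasing (psi : R -> R) :
  (forall t, 0 <= t <= 1 -> exists2 eta, 0 < eta &
     forall t', 0 <= t' <= 1 -> `|t' - t| < eta ->
       (t <= t' -> psi t <= psi t') /\ (t' <= t -> psi t' <= psi t)) ->
  psi 0 <= psi 1.
Proof.
move=> loc; pose S := [set t | 0 <= t <= 1 /\ psi 0 <= psi t].
have S0 : S 0 by split; rewrite ?lexx ?ler01.
have hS : has_sup S by split; [exists 0|exists 1 => t [/andP[]]].
set c := sup S.
have c0 : 0 <= c by apply: sup_ubound => //; exact: hS.2.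
have c1 : c <= 1 by apply: ge_sup; [exists 0|move=> t [/andP[]]].
have [eta eta0 hc] := loc c (introT andP (conj c0 c1)).
have [s [s01 sp] cs] := sup_adherent eta0 hS.
have sc : s <= c by apply: sup_ubound; [exact: hS.2|split].
have pc : psi 0 <= psi c.
  apply: le_trans sp _; apply: (hc s s01 _).2 => //.
  by rewrite ler0_norm ?subr_le0// opprB ltrBlDl -ltrBlDr.
have [cE|cn1] := eqVneq c 1; first by rewrite -cE.
have clt : c < 1 by rewrite lt_neqAle cn1.
pose t := Num.min (c + eta / 2) 1.
have ct : c < t by rewrite lt_min clt andbT ltrDl divr_gt0.
have t1 : t <= 1 by rewrite ge_min lexx orbT.
have tc : t <= c + eta / 2 by rewrite ge_min lexx.
have t01 : 0 <= t <= 1 by rewrite t1 andbT (le_trans c0)// ltW.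
have St : S t.
  split=> //; apply: le_trans pc _; apply: (hc t t01 _).1; last exact: ltW.
  rewrite ger0_norm ?subr_ge0 ?ltW// (@le_lt_trans _ _ (eta / 2))//.
    by rewrite lerBlDl.
  by rewrite ltr_pdivrMr// ltr_pMr// ltr1n.
by have := sup_ubound hS.2 St; rewrite -/c leNgt ct.
Qed.

End LocallyIncreasing.

Lemma trmxBK (V : zmodType) m n (A B : 'M[V]_(m, n)) : A - B = (A^T - B^T)^T.
Proof. by apply/matrixP => i j; rewrite !mxE. Qed.

(** * Directional bounds for the derivative of the smoothed response *)

Section Smoothing.
Context {R : realType} (n m N : nat).
Context (U : set 'rV[R]_n) (P : 'I_N -> set 'rV[R]_n).
Context (y : 'rV[R]_n -> 'rV[R]_m) (yi : 'I_N -> 'rV[R]_n -> 'rV[R]_m).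
Hypotheses (oU : open U) (yP : piecewise_C11 U P y yi).

Lemma piecewise_mvt (a w : 'rV[R]_n) (p : 'rV[R]_m) mu :
  (forall t, 0 <= t <= 1 -> U (a + t *: w)) ->
  (forall t i, 0 <= t <= 1 -> P i (a + t *: w) ->
     mu <= dot p (w *m jacobian (yi i) (a + t *: w))) ->
  mu <= dot p (y (a + w) - y a).
Proof.
move=> Uw hmu; apply/ler_addgt0Pr => e e0.
(* Lowering the slope by e leaves room for the first-order remainders, so that psi is locally
   increasing in the above sense. *)
pose psi t := dot p (y (a + t *: w)) - (mu - e) * t.
suff : psi 0 <= psi 1.
  by rewrite /psi scale0r scale1r addr0 mulr0 mulr1 subr0 dotBr; lra.
apply: locally_nondecreasing => t t01.
have [e1 e10 near_u] := pieces_near oU yP (Uw t t01).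
set u := a + t *: w in near_u.
(* With a remainder e / C times |h| and h = (t' - t) w, pairing with p costs at most e |t' - t|; the
   + 1 keeps C positive. *)
pose C := enorm p * enorm w + 1.
have C0 : 0 < C by rewrite ltr_wpDl// mulr_ge0// enorm_ge0.
have [e2 e20 hd] : exists2 d, 0 < d & forall h, enorm h < d -> forall i, P i u ->
    enorm (yi i (u + h) - yi i u - h *m jacobian (yi i) u) <= e / C * enorm h.
  apply: (@fin_radius _ _ _ (@enorm R n) (fun i h => P i u ->
    enorm (yi i (u + h) - yi i u - h *m jacobian (yi i) u) <= e / C * enorm h)) => i.
  have [Pu|nPu] := pselect (P i u); last by exists 1 => // h _ /nPu.
  have eC : 0 < e / C by rewrite divr_gt0.
  have [d d0 dh] := (frechetP (yi i) u _).2
    (conj (piece_differentiable yP Pu) erefl) _ eC.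
  by exists d => // h /dh.
have w1 : 0 < enorm w + 1 by rewrite ltr_wpDl// enorm_ge0.
exists (Num.min e1 e2 / (enorm w + 1)); first by rewrite divr_gt0// lt_min e10.
move=> t' t01' tt'.
pose h := (t' - t) *: w.
have hE : enorm h = `|t' - t| * enorm w by rewrite enormZ.
have hlt : enorm h < Num.min e1 e2.
  apply: (@le_lt_trans _ _ (`|t' - t| * (enorm w + 1))).
    by rewrite hE ler_wpM2l// lerDl.
  by rewrite -ltr_pdivlMr.
move: hlt; rewrite lt_min => /andP[he1 he2].
have uhE : a + t' *: w = u + h by apply/rowP => k; rewrite !mxE; ring.
have [Uuh Puh] : U (u + h) /\ forall i, P i (u + h) -> P i u.
  by apply: near_u; rewrite addrAC subrr add0r.
(* The piece is picked at the new point, hence depends on t'. It contains u as well, so y agrees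
   with [yi i] at both ends, even if the segment crosses other pieces in between. *)
have [i Pi] := piece_cover yP Uuh; have Pu := Puh i Pi.
have gmu := hmu t i t01 Pu; have := hd h he2 i Pu.
rewrite -/u -(piece_eq yP Pi) -(piece_eq yP Pu) in gmu *.
move: gmu; set G := dot p (w *m _) => gmu hdi.
have est : `|dot p (y (u + h)) - dot p (y u) - (t' - t) * G| <= e * `|t' - t|.
  have -> : dot p (y (u + h)) - dot p (y u) - (t' - t) * G =
      dot p (y (u + h) - y u - h *m jacobian (yi i) u).
    by rewrite !dotBr -scalemxAl dotZr.
  refine (le_trans (abs_dot_le _ _) _).
  refine (le_trans (ler_wpM2l (enorm_ge0 p) hdi) _).
  rewrite hE (_ : enorm p * _ = (e * `|t' - t|) * (enorm p * enorm w / C)); last first.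
    by field; rewrite gt_eqF.
  apply: ler_piMr; first by rewrite mulr_ge0// ltW.
  by rewrite ler_pdivrMr// mul1r lerDl.
have [est1 est2] : - (e * `|t' - t|) <= dot p (y (u + h)) - dot p (y u) - (t' - t) * G
    /\ dot p (y (u + h)) - dot p (y u) - (t' - t) * G <= e * `|t' - t|.
  by move: est; rewrite ler_norml => /andP.
rewrite /psi uhE -/u; split => [lett|lett].
  have h1 : 0 <= (t' - t) * (G - mu) by rewrite mulr_ge0 ?subr_ge0.
  by move: est1; rewrite ger0_norm ?subr_ge0//; lra.
have h1 : 0 <= (t - t') * (G - mu) by rewrite mulr_ge0 ?subr_ge0.
by move: est2; rewrite ler0_norm ?subr_le0//; lra.
Qed.

Variables (x : 'rV[R]_n) (delta : R) (L : 'I_N -> R).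
Hypotheses (delta0 : 0 < delta) (Bx : cball x delta `<=` U).
Hypothesis reg : regular P delta x.
Hypothesis JL : forall i, active P x i -> exists W, [/\ open W,
  closure (P i) `<=` W & lipschitz_in (@opnorm R m n) (L i) W (Jac (yi i))].

Lemma cball_compact : compact (cball x delta).
Proof.
apply: bounded_closed_compact; last exact: closed_cball.
exists (enorm x + delta); split; first exact: num_real.
move=> z hz s sx; apply: le_trans (ltW hz); apply: le_trans (mxnorm_le_enorm _) _.
by rewrite -(subrK x s) addrC (le_trans (enormD _ _))// lerD2l.
Qed.

Lemma regular_radius : exists2 rho, 0 < rho & forall s,
  enorm (s - x) < delta + rho -> U s /\ forall i, P i s -> active P x i.
Proof.
pose Q (r : R) (s : 'rV[R]_n) := forall v, enorm v < r ->
  U (s + v) /\ forall i, P i (s + v) -> active P x i.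
(* Near each s, half the radius of [pieces_near] works for all neighbouring centres; compactness of
   the ball then gives one r for all. *)
have cov : \forall r \near 0^'+, cball x delta `<=` Q r.
  apply: (compact_near_coveringP _).1 cball_compact _ _ _ _ _ => s sx.
  have [e e0 near_s] := pieces_near oU yP (Bx sx).
  exists ([set s' | enorm (s' - s) < e / 2], [set r | r < e / 2]).
    split=> /=; first by apply/nbhs_enormP; exists (e / 2); rewrite ?divr_gt0.
    by apply: nbhs_right_lt; rewrite divr_gt0.
  move=> [s' r] /= [ss' re] v vr.
  have [|? h] := near_s (s' + v).
    rewrite addrAC; apply: le_lt_trans (enormD _ _) _.
    by rewrite (splitr e) ltrD// (lt_trans vr).
  split=> // i Pi; apply: reg; exists s; split; [exact: h|exact: sx].
have [rho [rho0 hrho]] : exists r, 0 < r /\ cball x delta `<=` Q r.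
  have [r [? ?]] := filter_ex (filterI (nbhs_right_gt (0 : R)) cov).
  by exists r.
exists rho => // s sx.
have [le|lt] := leP (enorm (s - x)) delta.
  by rewrite -(addr0 s); apply: (hrho s le); rewrite enorm0.
have sx0 : 0 < enorm (s - x) by apply: lt_trans lt.
(* Radial projection onto the sphere of radius delta: s - s' has norm |s - x| - delta < rho. *)
pose s' := x + (delta / enorm (s - x)) *: (s - x).
have s'x : cball x delta s'.
  rewrite /cball/= /s' addrAC subrr add0r enormZ gtr0_norm ?divr_gt0//.
  by rewrite divfK ?gt_eqF.
have sE : s = s' + (1 - delta / enorm (s - x)) *: (s - x).
  by apply/rowP => i; rewrite !mxE; ring.
rewrite {1 2}sE; apply: hrho => //; rewrite enormZ ger0_norm; last first.
  by rewrite subr_ge0 ler_pdivrMr// mul1r ltW.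
by rewrite mulrBl mul1r divfK ?gt_eqF// ltrBlDl.
Qed.

Let c := max_active P L x.
Let c0 : 0 <= c. Proof. exact: max_active_ge0. Qed.

Lemma piece_dot_lip p w i s : P i s -> active P x i ->
  `|dot p (w *m jacobian (yi i) s) - dot p (w *m jacobian (yi i) x)|
  <= enorm p * (c * enorm (s - x) * enorm w).
Proof.
move=> Ps Px; rewrite -dotBr -mulmxBr.
have -> : jacobian (yi i) s - jacobian (yi i) x = (Jac (yi i) s - Jac (yi i) x)^T.
  exact: trmxBK.
refine (le_trans (abs_dot_le _ _) _); rewrite ler_wpM2l ?enorm_ge0//.
refine (le_trans (enorm_mulmx_le _ _) _); rewrite ler_wpM2r ?enorm_ge0//.
exact: (piece_Jac_lip JL Ps Px).
Qed.

Lemma ball_segment (a w : 'rV[R]_n) r t : 0 <= t <= 1 ->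
  enorm (a - x) < r -> enorm (a + w - x) < r -> enorm (a + t *: w - x) < r.
Proof.
move=> /andP[t0 t1] ar awr.
have -> : a + t *: w - x = (1 - t) *: (a - x) + t *: (a + w - x).
  by apply/rowP => i; rewrite !mxE; ring.
refine (le_lt_trans (enormD _ _) _).
rewrite !enormZ ger0_norm ?subr_ge0// ger0_norm//.
have [->|tn0] := eqVneq t 0; first by rewrite subr0 mul1r mul0r addr0.
have tp : 0 < t by rewrite lt_def tn0.
have h1 : (1 - t) * enorm (a - x) <= (1 - t) * r.
  by rewrite ler_wpM2l ?subr_ge0// ltW.
have h2 : t * enorm (a + w - x) < t * r by rewrite ltr_pM2l.
by lra.
Qed.

(** The points to control may lie farther than delta from x, so the constant is derived from the
    active pieces on the enlarged ball, through [piecewise_mvt] applied in both directions. *)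
Lemma response_lip rho (p : 'rV[R]_m) : 0 < rho ->
  (forall s, enorm (s - x) < delta + rho -> U s /\ forall i, P i s -> active P x i) ->
  exists2 Lf, 0 <= Lf & forall s t, enorm (s - x) < delta + rho ->
    enorm (t - x) < delta + rho ->
    `|dot p (y s) - dot p (y t)| <= Lf * enorm (s - t).
Proof.
(* A sum over all pieces is a crude uniform bound for their Jacobians at x; moving away from x adds
   at most c (delta + rho). *)
move=> rho0 hrho; pose M := \sum_i opnorm (Jac (yi i) x).
have M0 : 0 <= M by apply: sumr_ge0 => i _; exact: opnorm_ge0.
have MJ i : opnorm (Jac (yi i) x) <= M.
  by rewrite /M (bigD1 i)//= lerDl sumr_ge0// => j _; exact: opnorm_ge0.
have dr0 : 0 < delta + rho by rewrite addr_gt0.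
pose Lf := enorm p * (M + c * (delta + rho)).
have cd0 : 0 <= c * (delta + rho) by rewrite mulr_ge0// ltW.
have Lf0 : 0 <= Lf by rewrite mulr_ge0 ?enorm_ge0// addr_ge0.
have low a w : enorm (a - x) < delta + rho -> enorm (a + w - x) < delta + rho ->
    - (Lf * enorm w) <= dot p (y (a + w) - y a).
  move=> ar awr; apply: piecewise_mvt => [t t01|t i t01 Pi].
    exact: (hrho _ (ball_segment t01 ar awr)).1.
  have tr := ball_segment t01 ar awr.
  have ai := (hrho _ tr).2 i Pi.
  rewrite lerNl; refine (le_trans (ler_norm _) _); rewrite normrN.
  refine (le_trans (abs_dot_le _ _) _); rewrite /Lf -mulrA ler_wpM2l ?enorm_ge0//.
  rewrite -[jacobian _ _]trmxK; refine (le_trans (enorm_mulmx_le _ _) _).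
  rewrite ler_wpM2r ?enorm_ge0// -/(Jac (yi i) _).
  apply: opnorm_le => [|v]; first by rewrite addr_ge0.
  rewrite -(subrK (Jac (yi i) x) (Jac (yi i) _)) linearD/= mulmxDr mulrDl addrC.
  refine (le_trans (enormD _ _) _); apply: lerD; refine (le_trans (enorm_mulmx_le _ _) _);
    rewrite ler_wpM2r ?enorm_ge0//.
  refine (le_trans (piece_Jac_lip JL Pi ai) _).
  by rewrite ler_wpM2l// ltW.
exists Lf => // s t sx tx; rewrite -dotBr ler_norml; apply/andP; split.
  have := low t (s - t) tx; rewrite (addrC t) subrK; exact.
have := low s (t - s) sx; rewrite (addrC s) subrK => /(_ tx).
by rewrite (enormBC t) dotBr (dotBr p (y s)); lra.
Qed.

(** Linearity of the mean moves p inside the coordinatewise smoothing, reducing vector estimates to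
    scalar ball means. *)
Lemma ball_mean_dot rho p u : 0 < rho ->
  (forall s, enorm (s - x) < delta + rho -> U s /\ forall i, P i s -> active P x i) ->
  enorm (u - x) < rho ->
  dot p (smoothing y delta u) = ball_mean (fun xi => dot p (y (u + delta *: xi))).
Proof.
move=> rho0 hrho ux.
have yint j : ball_integrable (fun xi => y (u + delta *: xi) 0 j).
  have [Lf Lf0 fL] := response_lip (delta_mx 0 j) rho0 hrho.
  have := ball_integrable_lip delta0 rho0 Lf0 fL ux.
  by under eq_fun do rewrite dot_delta (addrC x) subrK.
rewrite {2}/dot ball_mean_sum => [|j]; last exact: ball_integrableZ.
by apply: eq_bigr => j _; rewrite mxE ball_meanZ.
Qed.

(** Each coordinate is a ball mean of a Lipschitz function, so [ball_mean_frechet] gives its slope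
    with a quadratic remainder; the slopes are the columns of [A]. *)
Lemma smoothing_differentiable : differentiable (smoothing y delta) x.
Proof.
have [rho rho0 hrho] := regular_radius.
have hj j : exists q K, exists2 r, 0 < r & forall h, enorm h < r ->
    `|(smoothing y delta (x + h) - smoothing y delta x) 0 j - dot q h|
    <= K * enorm h ^+ 2.
  have [Lf Lf0 fL] := response_lip (delta_mx 0 j) rho0 hrho.
  have [q [K [r r0 hr]]] := ball_mean_frechet delta0 rho0 Lf0 fL.
  exists q, K, (Num.min r rho); first by rewrite lt_min r0.
  move=> h; rewrite lt_min => /andP[hr' hrho']; have := hr h hr'.
  rewrite -!(ball_mean_dot _ rho0 hrho) ?addrK ?subrr ?enorm0//.
    by rewrite !dot_delta !mxE.
  by rewrite addrAC subrr add0r.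
pose A : 'M[R]_(n, m) := \matrix_(k, j) (projT1 (cid (hj j))) 0 k.
suff : differentiable (smoothing y delta) x /\ jacobian (smoothing y delta) x = A.
  by case.
apply/frechetP => e e0.
have m0 : 0 < e / m.+1%:R by rewrite divr_gt0.
have [d d0 hd] : exists2 d, 0 < d & forall h, enorm h < d -> forall j,
    `|(smoothing y delta (x + h) - smoothing y delta x - h *m A) 0 j|
    <= e / m.+1%:R * enorm h.
  apply: (@fin_radius _ _ _ (@enorm R n) (fun j h =>
    `|(smoothing y delta (x + h) - smoothing y delta x - h *m A) 0 j|
    <= e / m.+1%:R * enorm h)) => j.
  have [K [r r0 hr]] := projT2 (cid (hj j)).
  have K1 : 0 < `|K| + 1 by rewrite ltr_wpDl.
  (* Below this radius K |h|^2 is at most e / (m + 1) times |h|; dividing by m + 1 pays for the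
     passage from coordinates to the Euclidean norm. *)
  exists (Num.min r (e / m.+1%:R / (`|K| + 1))); first by rewrite lt_min r0 divr_gt0.
  move=> h; rewrite lt_min => /andP[hhr]; rewrite ltr_pdivlMr// => hK.
  have -> : (smoothing y delta (x + h) - smoothing y delta x - h *m A) 0 j =
      (smoothing y delta (x + h) - smoothing y delta x) 0 j
      - dot (projT1 (cid (hj j))) h.
    rewrite mxE; congr (_ + _); rewrite 2!mxE; congr (- _).
    by apply: eq_bigr => k _; rewrite mxE mulrC.
  refine (le_trans (hr h hhr) _); rewrite expr2 mulrA ler_wpM2r ?enorm_ge0//.
  refine (le_trans _ (ltW hK)); rewrite mulrC ler_wpM2l ?enorm_ge0//.
  by refine (le_trans (ler_norm K) _); rewrite lerDl.
exists d => // h hhd; refine (le_trans (enorm_le_mxnorm _) _).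
rewrite mulrC -ler_pdivlMr// mulrAC; apply: mxnorm_le.
  by rewrite mulr_ge0 ?enorm_ge0// ltW.
by move=> i j; rewrite ord1; exact: hd.
Qed.

(** The index i minimizes the slope in direction q among the active pieces. Averaged increments over
    segments of length t |q| are bounded below by that slope less a drift c (delta + t |q|) of the
    Jacobians; as t tends to 0 only the delta part survives. *)
Lemma smoothing_dir (p : 'rV[R]_m) (q : 'rV[R]_n) :
  exists2 i, active P x i & dot p (q *m jacobian (yi i) x)
    <= dot p (q *m jacobian (smoothing y delta) x) + enorm p * c * delta * enorm q.
Proof.
have [rho rho0 hrho] := regular_radius.
have Ux : U x by apply: Bx; exact: cball_center.
have [i0 Pi0] := piece_cover yP Ux.
have ai0 : i0 \in active P x by apply/mem_set; exact: subset_closure.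
pose G j := dot p (q *m jacobian (yi j) x).
have [i ai imin] := arg_minP G ai0.
suff le : G i <= dot p (q *m jacobian (smoothing y delta) x)
    + enorm p * c * delta * enorm q.
  by exists i; [exact: set_mem|exact: le].
have {}imin j : active P x j -> G i <= G j.
  by move=> aj; apply: imin; exact: mem_set.
move: (G i) imin => mu imin.
have shift_le (a b k e1 e2 : R) : - e1 <= a - b -> k <= b -> e1 <= e2 -> k - e2 <= a.
  by lra.
apply/ler_addgt0Pr => e e0.
have p0 := enorm_ge0 p; have q0 := enorm_ge0 q.
pose C := enorm p * enorm q + 1.
have C0 : 0 < C by rewrite ltr_wpDl// mulr_ge0.
pose C' := enorm p * (c * enorm q * enorm q) + 1.
have C'0 : 0 < C' by rewrite ltr_wpDl// !mulr_ge0.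
have eC : 0 < e / 2 / C by rewrite !divr_gt0.
have [d d0 hd] := (frechetP _ x _).2 (conj smoothing_differentiable erefl) _ eC.
have q1 : 0 < enorm q + 1 by rewrite ltr_wpDl.
(* The first entry keeps t q within both the differentiability radius d and rho; the second makes
   the part of the drift proportional to t at most e / 2, the other half of e going to the
   first-order remainder. *)
pose t := Num.min (Num.min d rho / (enorm q + 1) / 2) (e / 2 / C').
have t0 : 0 < t by rewrite !lt_min !divr_gt0// lt_min d0.
have tq : enorm (t *: q) < Num.min d rho.
  rewrite enormZ gtr0_norm//.
  have h1 : t * (enorm q + 1) <= Num.min d rho / 2.
    by rewrite -ler_pdivlMr// mulrAC ge_min lexx.
  have h2 : 0 < Num.min d rho by rewrite lt_min d0.
  move: h1 h2; rewrite mulrDr mulr1; move: (Num.min d rho) (t * enorm q) t0 => ? ? ?; lra.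
have tC : t * C' <= e / 2.
  by rewrite -ler_pdivlMr// ge_min lexx orbT.
move: tq; rewrite lt_min => /andP[tqd tqr].
have incr : t * (mu - enorm p * (c * (delta + t * enorm q) * enorm q)) <=
    dot p (smoothing y delta (x + t *: q)) - dot p (smoothing y delta x).
  have xx : enorm (x - x) < rho by rewrite subrr enorm0.
  have xtq : enorm (x + t *: q - x) < rho by rewrite addrAC subrr add0r.
  rewrite (ball_mean_dot p rho0 hrho xx) (ball_mean_dot p rho0 hrho xtq).
  have [Lf Lf0 fL] := response_lip p rho0 hrho.
  apply: (ball_mean_incr_ge delta0 rho0 Lf0 fL tqr) => xi xi1.
  have dxi : enorm (delta *: xi) <= delta by rewrite enormZ gtr0_norm// ger_pMr.
  have -> : x + t *: q + delta *: xi = x + delta *: xi + t *: q by rewrite addrAC.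
  rewrite -dotBr; have hs r : 0 <= r <= 1 ->
      enorm (x + delta *: xi + r *: (t *: q) - x) <= delta + t * enorm q.
    move=> /andP[r0 r1].
    have -> : x + delta *: xi + r *: (t *: q) - x = delta *: xi + r *: (t *: q).
      by apply/rowP => k; rewrite !mxE; ring.
    refine (le_trans (enormD _ _) _); apply: lerD => //.
    rewrite [leLHS]enormZ (ger0_norm r0) enormZ (gtr0_norm t0).
    by rewrite ler_piMl// mulr_ge0// ltW.
  have hlt r : 0 <= r <= 1 ->
      enorm (x + delta *: xi + r *: (t *: q) - x) < delta + rho.
    move=> /hs /le_lt_trans; apply; rewrite ltrD2l.
    by move: tqr; rewrite enormZ gtr0_norm.
  apply: piecewise_mvt => [r r01|r j r01 Pj]; first exact: (hrho _ (hlt r r01)).1.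
  have aj := (hrho _ (hlt r r01)).2 j Pj.
  rewrite -scalemxAl dotZr ler_pM2l//.
  have := piece_dot_lip p q Pj aj; rewrite ler_norml => /andP[h _].
  have h2 := imin j aj.
  have h3 : enorm p * (c * enorm (x + delta *: xi + r *: (t *: q) - x) * enorm q)
      <= enorm p * (c * (delta + t * enorm q) * enorm q).
    by rewrite ler_wpM2l// ler_wpM2r// ler_wpM2l// hs.
  exact: (shift_le _ _ _ _ _ h h2 h3).
have := hd (t *: q) tqd; set A := jacobian _ _ => hA.
have upp : dot p (smoothing y delta (x + t *: q)) - dot p (smoothing y delta x)
    - t * dot p (q *m A) <= t * (e / 2).
  have -> : dot p (smoothing y delta (x + t *: q)) - dot p (smoothing y delta x)
      - t * dot p (q *m A) =
      dot p (smoothing y delta (x + t *: q) - smoothing y delta x - (t *: q) *m A).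
    by rewrite !dotBr -scalemxAl dotZr.
  refine (le_trans (dot_le_enorm _ _) _).
  refine (le_trans (ler_wpM2l p0 hA) _); rewrite enormZ gtr0_norm//.
  have -> : enorm p * (e / 2 / C * (t * enorm q)) = t * (e / 2) * (enorm p * enorm q / C).
    by field; rewrite gt_eqF.
  apply: ler_piMr; first by rewrite mulr_ge0 ?divr_ge0// ltW.
  by rewrite ler_pdivrMr// mul1r lerDl.
have {incr upp} h : t * (mu - enorm p * (c * (delta + t * enorm q) * enorm q))
    <= t * (dot p (q *m A) + e / 2).
  rewrite mulrDr; move: incr upp.
  move: (dot p (smoothing _ _ _)) (dot p (smoothing _ _ _)) => ? ?; lra.
rewrite ler_pM2l// in h.
have {}tC : t * (enorm p * (c * enorm q * enorm q)) <= e / 2.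
  by apply: le_trans tC; rewrite ler_pM2l// lerDl.
move: h tC; move: (dot p (q *m A)) (mu) (t) => ? ? ?; lra.
Qed.

End Smoothing.

Unset Implicit Arguments.

Theorem proposition4 (R : realType) (n m : nat)
  (* response mapping *)
  (X D : set 'rV[R]_n) (Y : set 'rV[R]_m)
  (g : 'rV[R]_n -> 'rV[R]_m -> R) (y : 'rV[R]_n -> 'rV[R]_m)
  (dbar Ly : R)
  (X_nonempty : X !=set0) (X_convex : convex_set X) (X_compact : compact X)
  (D_open : open D) (X_sub_D : X `<=` D)
  (y_argmin : forall x, D x ->
     [set xi | Y xi /\ forall z, Y z -> g x xi <= g x z] = [set y x])
  (y_loc_lip : locally_lipschitz D y)
  (dbar_gt0 : 0 < dbar) (enlarge_sub_D : enlarge X dbar `<=` D)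
  (y_bounded : exists M, forall u, enlarge X dbar u -> enorm (y u) <= M)
  (y_lip : lipschitz_in (@enorm R m) Ly (enlarge X dbar) y)
  (* upper-level objective *)
  (phi : 'rV[R]_n * 'rV[R]_m -> R) (L1x L1y L2x L2y My : R)
  (phi_C1 : C1 phi)
  (L1x_gt0 : 0 < L1x) (L1y_gt0 : 0 < L1y) (L2x_gt0 : 0 < L2x)
  (L2y_gt0 : 0 < L2y) (My_gt0 : 0 < My)
  (grad1_lip : forall u v, X u -> X v ->
     enorm (grad1 phi (u, y u) - grad1 phi (v, y v))
       <= L1x * enorm (u - v) + L1y * enorm (y u - y v))
  (grad2_lip : forall u v, X u -> X v ->
     enorm (grad2 phi (u, y u) - grad2 phi (v, y v))
       <= L2x * enorm (u - v) + L2y * enorm (y u - y v))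
  (grad2_bounded : forall u, X u -> enorm (grad2 phi (u, y u)) <= My)
  (* base point and smoothing radius *)
  (x : 'rV[R]_n) (delta : R)
  (x_in_X : X x) (delta_gt0 : 0 < delta) (delta_le : delta <= dbar)
  (* piecewise structure *)
  (U : set 'rV[R]_n) (N : nat) (P : 'I_N -> set 'rV[R]_n)
  (yi : 'I_N -> 'rV[R]_n -> 'rV[R]_m) (L : 'I_N -> R)
  (U_open : open U) (U_sub_D : U `<=` D) (X_sub_U : X `<=` U)
  (ball_sub_U : cball x delta `<=` U)
  (y_piecewise : piecewise_C11 U P y yi)
  (Jac_lip : forall i, active P x i -> exists W, [/\ open W,
     closure (P i) `<=` W & lipschitz_in (@opnorm R m n) (L i) W (Jac (yi i))])
  (x_regular : regular P delta x) :
  (clarke_variation D y x delta <= (max_active P L x * delta)%:E)%E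
  /\
  (edist (@enorm R n) (bizol_hypergrad phi y delta x)
     (clarke_subdiff D (fun u => phi (u, y u)) x)
   <= (enorm (grad2 phi (x, y x)) * max_active P L x * delta)%:E)%E.
Proof.
have [dphi _] := phi_C1.
split.
  exact: (clarke_variation_le U_open y_piecewise U_sub_D delta_gt0 ball_sub_U
    x_regular Jac_lip).
have Ux : U x by exact: X_sub_U.
have [i0 Pi0] := piece_cover y_piecewise Ux.
(* The vertices are indexed by all of 'I_N: inactive indices are redirected to a piece containing x,
   so that every vertex is a limiting gradient. *)
pose idx i := if `[< P i x >] then i else i0.
have Pidx i : P (idx i) x by rewrite /idx; case: ifPn => // /asboolP.
rewrite /bizol_hypergrad; set p := grad2 phi _; set dx := grad1 phi _.
apply: (edist_conv_le (v := fun i => dx + p *m Jac (yi (idx i)) x)).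
- by rewrite !mulr_ge0 ?enorm_ge0 ?max_active_ge0 ?ltW.
- by move=> i; exact: (piece_limiting_grad y_piecewise U_sub_D phi_C1 (Pidx i)).
move=> q.
have [i ai hi] := smoothing_dir U_open y_piecewise delta_gt0 ball_sub_U
  x_regular Jac_lip p q.
have Pi := active_piece y_piecewise delta_gt0 ball_sub_U ai.
have idxi : idx i = i by rewrite /idx asboolT.
have dotJ (F : 'rV[R]_n -> 'rV[R]_m) :
    dot q (dx + p *m Jac F x) = dot q dx + dot p (q *m jacobian F x).
  by rewrite dotDr (dotC q (p *m _)) dot_mulmx trmxK.
have vE : dot q (dx + p *m Jac (yi (idx i)) x) =
    dot q dx + dot p (q *m jacobian (yi i) x).
  by rewrite idxi; exact: dotJ.
have le_shift (a b c u w r : R) : u = a + b -> w = a + c -> b <= c + r -> u <= w + r.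
  by move=> -> -> bcr; rewrite -addrA lerD2l.
by exists i; exact: (le_shift _ _ _ _ _ _ vE (dotJ (smoothing y delta)) hi).
Qed.
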